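(* For all $N\in\mathbb{N}$ we have $$d_{W,1}(P^{00}_N,P^{00})\le\frac1N\cdot\frac{9\left(9N^3-54N^2+64N-16\right)}{(N-2)^3}.$$
   Context: $\mathbb{N}=\{1,2,\dots\}$. $P^{00}$ is the law of the bridge, from and to $0$ on $[0,1]$, of the continuous-time random walk on $\mathbb{Z}$ started at $0$ which jumps up by one at rate $1$ and down by one at rate $1$ (i.e. the walk conditioned on $X_1=0$). Approximation scheme: let $N\in\mathbb{N}$ be fixed. On a sufficiently large probability space with measure $Q$ let $\xi_1,\dots,\xi_N,\tau_1,\dots,\tau_N$ be independent, with $Q(\xi_j=1)=Q(\xi_j=-1)=1/N$, $Q(\xi_j=0)=1-2/N$ and $\tau_j$ uniform on $I_j:=((j-1)/N,j/N]$ for $j=1,\dots,N$. Set $Y_t:=\sum_{j=1}^N\xi_j\mathbf{1}_{[\tau_j,1]}(t)$, $t\in[0,1]$, let $P^0_N$ be the law of $Y$ on the space $\mathbb{D}([0,1];\mathbb{Z})$ of càdlàg paths, and $P^{00}_N:=P^0_N(\cdot\mid Y_1=0)$. $\mathscr{U}$ is the set of pairs $U=(U^+,U^-)$ of finite disjoint subsets of $(0,1)$ with $|U^+|=|U^-|$. Piecewise constant càdlàg paths on $[0,1]$ from $0$ to $0$ with jumps $\pm1$ are in bijection with $\mathscr{U}$ by sending a path to ($U^+$ = set of times of $+1$ jumps, $U^-$ = set of times of $-1$ jumps). $\mathscr{U}$ carries the $\sigma$-algebra transported by this bijection, and $P^{00},P^{00}_N$ are identified with their push-forwards to $\mathscr{U}$.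 Let $\mathscr{A}=(0,1)^2\setminus\{(u,u):u\in(0,1)\}$. For $(r,s)\in\mathscr{A}$ define $\Psi_{r,s}:\mathscr{U}\to\mathscr{U}$ by $\Psi_{r,s}U=(U^+\cup\{r\},U^-\cup\{s\})$ if $r\notin U^+$, $s\notin U^-$; $\Psi_{r,s}U=(U^+\setminus\{r\},U^-\setminus\{s\})$ if $r\in U^+$, $s\in U^-$; and $\Psi_{r,s}U=U$ otherwise (also $\Psi_{r,s}U=U$ if the first rule would give a pair not in $\mathscr{U}$, i.e. if $r\in U^-$ or $s\in U^+$; for each $U$ this concerns only a Lebesgue-null set of $(r,s)$). $d$ is the graph distance on $\mathscr{U}$ for which $U\ne V$ are neighbours iff $U=\Psi_{r,s}V$ for some $(r,s)\in\mathscr{A}$. $d_{W,1}$ is the $1$-Wasserstein distance on $(\mathscr{U},d)$: $\mathrm{Lip}_1(\mathscr{U})$ is the set of measurable $f:\mathscr{U}\to\mathbb{R}$ with $|f(U)-f(V)|\le d(U,V)$, and $d_{W,1}(\mu,\nu)=\sup\{|\int f\,d\mu-\int f\,d\nu|:f\in\mathrm{Lip}_1(\mathscr{U}),\ f\ \mu\text{- and }\nu\text{-integrable}\}$.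
   Formalization: Stated for N ≥ 5 instead of all N: for N = 3 and N = 4 the right-hand side is negative (−201 and −13.5) while the distance is nonnegative, for N = 2 its denominator vanishes, and for N = 1 the scheme would need Q(ξ_j=0) = −1. *)

(* Defs.v *)
From HB Require Import structures.
From mathcomp Require Import all_boot all_order all_algebra finmap.
From mathcomp Require Import all_classical all_reals all_analysis.

Set Implicit Arguments.
Unset Strict Implicit.
Unset Printing Implicit Defensive.

Import Order.TTheory GRing.Theory Num.Theory.
Import numFieldNormedType.Exports.

Local Open Scope classical_set_scope.
Local Open Scope ring_scope.

HB.instance Definition _ := isPointed.Build int 0.

HB.instance Definition _ := @isMeasurable.Build default_measure_display
  int discrete_measurable discrete_measurable0
  discrete_measurableC discrete_measurableU.

(* Pairs U = (U^+, U^-) of finite disjoint subsets of (0,1) of equal size. *)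

Definition is_jumps (R : realType) (U : {fset R} * {fset R}) : bool :=
  [&& all (fun t => 0 < t < 1) U.1, all (fun t => 0 < t < 1) U.2,
      [disjoint U.1 & U.2]%fset & #|` U.1| == #|` U.2| ].

Record jumps (R : realType) := Jumps {
  jumps_val :> {fset R} * {fset R};
  jumps_prop : is_jumps jumps_val }.

Arguments Jumps {R}.

HB.instance Definition _ (R : realType) := [isSub for @jumps_val R].
HB.instance Definition _ (R : realType) := [Choice of jumps R by <:].

Lemma is_jumps0 (R : realType) : @is_jumps R (fset0, fset0).
Proof. by apply/and4P; split; rewrite ?fdisjoint0X//; apply/allP => t; rewrite inE. Qed.

HB.instance Definition _ (R : realType) :=
  isPointed.Build (jumps R) (Jumps _ (is_jumps0 R)).

(* The inverse of the bijection between bridge paths and their jump times: the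
   cadlag path from 0 to 0 on [0,1] whose +1 jumps are at the times in U^+ and
   whose -1 jumps are at the times in U^-. *)
Definition path_of (R : realType) (U : jumps R) (t : R) : int :=
  (#|` [fset u in U.1 | u <= t]%fset|)%:Z - (#|` [fset u in U.2 | u <= t]%fset|)%:Z.

(* The sigma-algebra transported from the path space, where it is generated by
   the evaluations at the times of [0,1]. *)
Definition cylinders (R : realType) : set (set (jumps R)) :=
  [set C | exists t (k : int), 0 <= t <= 1 /\ C = [set U | path_of U t = k]].

HB.instance Definition _ (R : realType) :=
  @isMeasurable.Build (sigma_display (@cylinders R)) (jumps R)
    <<s @cylinders R >> (@sigma_algebra0 _ setT _) (@sigma_algebraC _ _)
    (@sigma_algebra_bigcup _ setT _).

(* [insubd U] also returns U when the enlarged pair would not be disjoint. *)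
Definition Psi (R : realType) (r s : R) (U : jumps R) : jumps R :=
  if (r \notin U.1) && (s \notin U.2) then insubd U (r |` U.1, s |` U.2)%fset
  else if (r \in U.1) && (s \in U.2) then insubd U (U.1 `\ r, U.2 `\ s)%fset
  else U.

Definition neighbours (R : realType) (U V : jumps R) : Prop :=
  U <> V /\ exists r s : R,
    [/\ 0 < r < 1, 0 < s < 1, r <> s & U = Psi r s V].

Definition walk (R : realType) (U V : jumps R) (p : seq (jumps R)) : Prop :=
  path (fun A B => `[< neighbours A B >]) U p /\ last U p = V.

Definition gdist (R : realType) (U V : jumps R) : \bar R :=
  ereal_inf [set ((size p)%:R)%:E | p in walk U V].

Definition Lip1 (R : realType) (f : jumps R -> R) : Prop :=
  measurable_fun [set: jumps R] f /\
  forall U V : jumps R, (`|f U - f V|%:E <= gdist U V)%E.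

Definition dW1 (R : realType) (mu nu : probability (jumps R) R) : \bar R :=
  ereal_sup [set (`| Rintegral mu setT f - Rintegral nu setT f |)%:E
    | f in [set f : jumps R -> R |
        [/\ Lip1 f, mu.-integrable setT (EFin \o f)
          & nu.-integrable setT (EFin \o f)]]].

Definition independent (d : measure_display) (T : measurableType d)
    (R : realType) (P : probability T R) (I : choiceType)
    (F : I -> set (set T)) : Prop :=
  forall (J : {fset I}) (A : I -> set T),
    (forall i, i \in J -> F i (A i)) ->
    P (\bigcap_(i in [set` J]) A i) = (\prod_(i <- J) P (A i))%E.

(* mu is the law of the process X conditioned on X_1 = 0, read on jump times.
   V is the jump-time pair of the path of X; as the path only almost surely has
   the required form, V is determined up to a null set. *)
Definition bridge_law (d : measure_display) (T : measurableType d)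
    (R : realType) (P : probability T R) (X : R -> T -> int)
    (mu : probability (jumps R) R) : Prop :=
  exists2 V : {RV P >-> jumps R},
    {ae P, forall w, X 1 w = 0 ->
       forall t, 0 <= t <= 1 -> X t w = path_of (V w) t} &
    forall B, measurable B ->
      mu B = (fine (P ([set w | X 1 w = 0] `&` V @^-1` B))
              / fine (P [set w | X 1 w = 0]))%:E.

(* [poisson_pmf] is not the Dirac mass at 0 for the parameter 0, hence the
   strict inequality on the times. *)
Definition rate1_poisson_process (d : measure_display) (T : measurableType d)
    (R : realType) (P : probability T R) (C : R -> {RV P >-> nat}) : Prop :=
  [/\ forall w, C 0 w = 0%N,
      forall w s t, 0 <= s -> s <= t -> (C s w <= C t w)%N,
      forall w t, 0 <= t -> \forall s \near t^'+, C s w = C t w,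
      forall s t k, 0 <= s -> s < t ->
        P [set w | (C t w - C s w)%N = k] = (poisson_pmf (t - s) k)%:E &
      forall (m : nat) (t : nat -> R), 0 <= t 0%N ->
        (forall i, t i <= t i.+1) ->
        independent P (fun i : 'I_m =>
          g_sigma_algebra_preimage (fun w => (C (t i.+1) w - C (t i) w)%N))].

Definition process_sigma_algebra (d : measure_display) (T : measurableType d)
    (R : realType) (P : probability T R) (C : R -> {RV P >-> nat}) :
    set (set T) :=
  <<s \bigcup_(t in `[0, +oo[) g_sigma_algebra_preimage (C t) >>.

(* Up and down jumps at rate 1: the numbers C true t and C false t of up and of
   down jumps until time t are independent Poisson processes of rate 1. *)
Definition random_walk (d : measure_display) (T : measurableType d)
    (R : realType) (P : probability T R) (X : R -> T -> int) : Prop :=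
  exists C : bool -> R -> {RV P >-> nat},
    [/\ forall b, rate1_poisson_process (C b),
        independent P (fun b => process_sigma_algebra (C b)) &
        forall t w, 0 <= t -> X t w = (C true t w)%:Z - (C false t w)%:Z].

Lemma cell_lt (R : realType) (N : nat) (j : 'I_N) :
  j%:R / N%:R < j.+1%:R / N%:R :> R.
Proof.
by rewrite ltr_pM2r ?ltr_nat// invr_gt0 ltr0n (leq_trans _ (ltn_ord j)).
Qed.

(* Indices start at 0: the j-th time is uniform on (j/N, (j+1)/N], and closing
   this interval on the left does not change the uniform law. *)
Definition approximation_scheme (d : measure_display) (T : measurableType d)
    (R : realType) (Q : probability T R) (N : nat)
    (xi : 'I_N -> {RV Q >-> int}) (tau : 'I_N -> {RV Q >-> R}) : Prop :=
  [/\ independent Q (fun i : 'I_N + 'I_N =>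
        match i with
        | inl j => g_sigma_algebra_preimage (xi j)
        | inr j => g_sigma_algebra_preimage (tau j)
        end),
      forall j, [/\ Q [set w | xi j w = 1] = (N%:R^-1)%:E,
                    Q [set w | xi j w = -1] = (N%:R^-1)%:E &
                    Q [set w | xi j w = 0] = (1 - 2 / N%:R)%:E] &
      forall j B, measurable B ->
        distribution Q (tau j) B = uniform_prob (cell_lt R j) B].

Definition scheme_path (d : measure_display) (T : measurableType d)
    (R : realType) (Q : probability T R) (N : nat)
    (xi : 'I_N -> {RV Q >-> int}) (tau : 'I_N -> {RV Q >-> R})
    (t : R) (w : T) : int :=
  \sum_(j < N | tau j w <= t) xi j w.

(* Main.v *)
Require Import Defs.
From mathcomp Require Import all_boot all_order all_algebra finmap.
From mathcomp Require Import all_classical all_reals all_analysis.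
From mathcomp Require Import measurable_realfun.
From mathcomp Require Import zify ring lra.

Set Implicit Arguments.
Unset Strict Implicit.
Unset Printing Implicit Defensive.

Import Order.TTheory GRing.Theory Num.Theory.
Import numFieldNormedType.Exports.

Local Open Scope classical_set_scope.
Local Open Scope ring_scope.

(** The distance of a configuration U to the empty one is at most the number
    #|U^+| of its up-jumps, since each step of the graph may delete one jump of
    each sign ([Lip1_le_card]).  Subtracting a constant from a test function f,
    one may therefore assume |f(U)| <= #|U^+|, and no transport is needed: it
    suffices to bound the difference of the two laws in total variation, weighted
    by #|U^+|, and this difference is already of order 1/N.

    Up to normalisation, the bridge of the walk has n jumps of each sign with
    weight 1/n!^2, at 2n independent uniform times.  The approximation has the
    density lambda^(2n), lambda = N/(N-2), with respect to this measure on the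
    event that no cell (j/N, (j+1)/N] contains two jumps, and the density 0
    elsewhere.  To see this without n-fold product measures, the event is cut
    according to the sign vector v, which records for each cell whether it has an
    up-jump, a down-jump or none.  For a balanced v the two laws restricted to v
    are proportional ([scheme_walk_law]): the sigma-algebra is generated by the
    positions at the points i/(N m), and on such a grid both processes are
    described by the subcell of each jump, every choice of subcells having
    probability (N m)^(-|v|) up to a factor which depends only on |v|.

    The mass which the walk gives to paths with n jumps of each sign, at least two
    of them in one cell, is a fraction of at most n(2n-1)/N (a birthday estimate,
    [signs_defect_le]), and for n >= 1 the weight which the approximation gives to
    n is at most 1 + (3N-4)/(N-2)^2 times 1/n!^2 ([ffact_ratio_le]).  Summing
    against n/n!^2 and n^2(2n-1)/n!^2 bounds the weighted difference of the
    unnormalised laws; as both total masses are at least 2, normalisation does not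
    increase this bound ([ratio_diff_le]).  The outcome, 2(3N-4)/(N-2)^2 + 13/N,
    lies below the claimed bound as soon as N >= 5 ([wasserstein_bound_le]). *)

(** * Lipschitz functions and the number of jumps *)

Section Paths.
Variable R : realType.
Implicit Types (U : jumps R) (t : R).

Lemma jumpsP U : [/\ forall x, x \in U.1 -> 0 < x < 1,
  forall x, x \in U.2 -> 0 < x < 1,
  forall x, x \in U.1 -> x \notin U.2 & #|` U.1| = #|` U.2|].
Proof.
have /and4P[/allP h1 /allP h2 /fdisjointP h3 /eqP h4] := jumps_prop U.
by split.
Qed.

(** Deleting one up-jump and one down-jump at a time leads to the empty
    configuration in #|U^+| steps. *)
Lemma gdist_empty U (V : jumps R) : jumps_val V = (fset0, fset0) ->
  (gdist U V <= (#|` U.1|%:R)%:E)%E.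
Proof.
move=> V0; apply: ereal_inf_lbound => /=.
suff [p [pU pV sp]] : exists p : seq (jumps R),
    [/\ path (fun A B => `[< neighbours A B >]) U p, last U p = V & size p = #|` U.1|].
  by exists p => //; rewrite sp.
move En : #|` U.1| => n; elim: n U En => [|n IH] U En.
  exists [::]; split => //=; apply: val_inj => /=.
  have [_ _ _ E2] := jumpsP U.
  rewrite V0 [LHS]surjective_pairing; congr pair; apply: cardfs0_eq => //.
  by rewrite -E2.
have [h1 h2 h3 E2] := jumpsP U.
have /fset0Pn[r rU] : U.1 != fset0 by rewrite -cardfs_gt0 En.
have /fset0Pn[s sU] : U.2 != fset0 by rewrite -cardfs_gt0 -E2 En.
have J' : is_jumps (U.1 `\ r, U.2 `\ s)%fset.
  apply/and4P; split => /=.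
  - by apply/allP => x; rewrite !inE => /andP[_]; exact: h1.
  - by apply/allP => x; rewrite !inE => /andP[_]; exact: h2.
  - by apply/fdisjointP => x; rewrite !inE => /andP[_ /h3 /negbTE ->]; rewrite andbF.
  - by move: E2; rewrite (cardfsD1 r U.1) (cardfsD1 s U.2) rU sU /= !add1n => -[->].
pose U' := Jumps _ J'.
have [|p [pp lp sp]] := IH U'.
  by move: En; rewrite (cardfsD1 r) rU add1n => -[].
exists (U' :: p); split => //=; last by rewrite sp.
apply/andP; split => //; apply/asboolP; split.
  move=> e; have : r \in U'.1 by rewrite -e.
  by rewrite /= !inE eqxx.
exists r, s; split; [exact: h1|exact: h2| |].
  by move=> e; move: (h3 _ rU); rewrite e sU.
rewrite /Psi /= !inE !eqxx /=.
rewrite !fsetD1K //.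
by apply: val_inj; rewrite val_insubd -surjective_pairing (jumps_prop U).
Qed.

Lemma Lip1_le_card (f : jumps R -> R) (V : jumps R) :
  jumps_val V = (fset0, fset0) -> Lip1 f ->
  forall U, `|f U - f V| <= #|` U.1|%:R.
Proof.
move=> V0 [_ h] U; rewrite -lee_fin; apply: le_trans (h U V) _.
exact: gdist_empty.
Qed.

(** If a path is the difference of two counting functions, then each of its
    up-jumps is a jump of the first: just before an up-jump u and back to the
    preceding jump time, the path is one unit lower than at u, and the second
    function can only have increased in between. *)
Lemma card_jumps_le U (a b : R -> nat) :
  (forall s t, 0 <= s -> s <= t -> t <= 1 -> (a s <= a t)%N) ->
  (forall s t, 0 <= s -> s <= t -> t <= 1 -> (b s <= b t)%N) ->
  (forall t, 0 <= t <= 1 -> path_of U t = (a t)%:Z - (b t)%:Z) ->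
  (#|` U.1| <= a 1%R)%N.
Proof.
move=> ha hb hp; have [h1 h2 h3 _] := jumpsP U.
suff main n t : 0 <= t <= 1 -> #|` [fset u in U.1 | u <= t]%fset| = n -> (n <= a t)%N.
  apply: (main _ 1); first by rewrite ler01 lexx.
  congr (#|` _|); apply/fsetP => x; rewrite !inE /=.
  by apply/andP/idP => [[]//|xU]; split => //; have /andP[_ /ltW] := h1 _ xU.
elim: n t => [//|n IH] t /andP[t0 t1] En.
pose A := [fset u in U.1 | u <= t]%fset.
have [u uA umax] : exists2 u, u \in A & forall x, x \in A -> x <= u.
  have /fset0Pn[x0 x0A] : A != fset0 by rewrite -cardfs_gt0 En.
  have [u /= uA umax] := @arg_maxP _ _ A [` x0A]%fset xpredT val isT.
  by exists (val u); [exact: valP|move=> x xA; exact: (umax [` xA]%fset)].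
have /andP[uU ut] : (u \in U.1) && (u <= t) by move: uA; rewrite !inE.
have /andP[u0 u1] := h1 _ uU.
(* The last jump time before u, or 0. *)
pose s := \big[Num.max/0]_(x <- (U.1 `|` U.2)%fset | x < u) x.
have s0 : 0 <= s by rewrite /s; elim/big_rec: _ => // x y _ y0; rewrite le_max y0 orbT.
have su : s < u by rewrite /s; elim/big_rec: _ => // x y xu yu; rewrite gt_max xu.
have smax x : x \in (U.1 `|` U.2)%fset -> x < u -> x <= s.
  by move=> xU xu; exact: (le_bigmax_seq 0 x (fun x => x < u) id).
have Efu : [fset v in U.1 | v <= u]%fset = (u |` [fset v in U.1 | v <= s])%fset.
  apply/fsetP => x; rewrite !inE /=; apply/idP/idP.
    move=> /andP[xU]; rewrite le_eqVlt => /orP[->//|xu].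
    by rewrite xU smax ?orbT// inE xU.
  move=> /orP[/eqP ->|/andP[-> xs]]; first by rewrite uU lexx.
  exact: le_trans xs (ltW su).
have Ef2 : [fset v in U.2 | v <= u]%fset = [fset v in U.2 | v <= s]%fset.
  apply/fsetP => x; rewrite !inE /=; apply/idP/idP.
    move=> /andP[xU]; rewrite le_eqVlt => /orP[/eqP xu|xu].
      by move: (h3 _ uU); rewrite -xu xU.
    by rewrite xU smax// inE xU orbT.
  move=> /andP[-> xs]; exact: le_trans xs (ltW su).
have Eft : A = [fset v in U.1 | v <= u]%fset.
  apply/fsetP => x; apply/idP/idP => [xA|].
    by rewrite !inE /= (umax _ xA) andbT; move: xA; rewrite !inE => /andP[].
  rewrite !inE => /andP[->/= xu]; exact: le_trans xu ut.
have cA : #|` A| = #|` [fset v in U.1 | v <= s]%fset|.+1.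
  by rewrite Eft Efu cardfsU1 !inE /= leNgt su andbF.
have In := IH s; move: cA; rewrite En => -[cs].
have s1 : 0 <= s <= 1 by rewrite s0 (le_trans (ltW su))// ltW.
have u01 : 0 <= u <= 1 by rewrite !ltW.
have {}In := In s1 (esym cs).
have aus := ha s u s0 (ltW su) (ltW u1).
have aut := ha u t (ltW u0) ut t1.
have bus := hb s u s0 (ltW su) (ltW u1).
have ps := hp _ s1; have pu := hp _ u01.
move: pu ps; rewrite /path_of Ef2 Efu cardfsU1 !inE /= leNgt su andbF /=.
rewrite -cs; move: In aus aut bus.
move: (a s) (a u) (a t) (b s) (b u) (#|` _|) => {}s0 {}u0 {}t0 bs bu c.
clear; lia.
Qed.
End Paths.

(** * Discrete time grids generate the sigma-algebra *)

Section Grid.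
Variable R : realType.
Implicit Types (U : jumps R) (t : R).

Definition grid_trace m U (i : 'I_m.+1) : int := path_of U (i%:R / m%:R).

(** The events which depend on finitely many equidistant times.  They form a
    pi-system, as two grids have a common refinement, and carry enough information
    because the paths are right-continuous. *)
Definition grid_sets : set (set (jumps R)) :=
  [set C | measurable C /\ exists m (S : set ('I_m.+1 -> int)),
    (0 < m)%N /\ C = grid_trace (m := m) @^-1` S].

Lemma grid_trace_refine m k : (0 < m)%N -> (0 < k)%N ->
  exists f : 'I_m.+1 -> 'I_(k * m).+1,
    forall U, grid_trace (m := m) U = grid_trace (m := k * m) U \o f.
Proof.
move=> m0 k0.
have lt (i : 'I_m.+1) : (k * i < (k * m).+1)%N by rewrite ltnS leq_pmul2l// -ltnS.
exists (fun i => Ordinal (lt i)) => U; apply/funext => i; rewrite /grid_trace /=.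
congr path_of; rewrite !natrM -mulf_div divff ?mul1r//.
by rewrite pnatr_eq0 -lt0n.
Qed.

Lemma grid_sets_setI : setI_closed grid_sets.
Proof.
move=> A B [mA [m [S [m0 eA]]]] [mB [k [S' [k0 eB]]]].
split; first exact: measurableI.
have [f Ef] := grid_trace_refine m0 k0.
have [g Eg] := grid_trace_refine k0 m0.
exists (k * m)%N; move: g Eg; rewrite [(m * k)%N]mulnC => g Eg.
exists [set h : 'I_(k * m).+1 -> int | S (h \o f) /\ S' (h \o g)].
split; first by rewrite muln_gt0 k0.
by rewrite eA eB; apply/seteqP; split => U /=; rewrite Ef Eg.
Qed.

Lemma path_of_right_cont U t : exists2 e : R, 0 < e &
  forall r, t <= r -> r < t + e -> path_of U r = path_of U t.
Proof.
pose e := \big[Num.min/1]_(x <- (U.1 `|` U.2)%fset | t < x) (x - t).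
have e0 : 0 < e.
  by rewrite /e; elim/big_rec: _ => // x y tx y0; rewrite lt_min y0 subr_gt0 tx.
exists e => // r tr re.
have key x : x \in (U.1 `|` U.2)%fset -> (x <= r) = (x <= t).
  move=> xU; apply/idP/idP => [xr|/le_trans]; last exact.
  rewrite leNgt; apply/negP => tx.
  have : e <= x - t by exact: (ge_bigmin_seq 1 x (fun x => t < x) (fun x => x - t)).
  by move: xr re; lra.
rewrite /path_of; congr (_%:Z - _%:Z); congr (#|` _|); apply/fsetP => x;
  rewrite !inE /=.
  by case: (boolP (x \in U.1)) => //= xU; rewrite key// inE xU.
by case: (boolP (x \in U.2)) => //= xU; rewrite key// inE xU orbT.
Qed.

Lemma grid_cylinder m (i : nat) (k : int) : (0 < m)%N -> (i <= m)%N ->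
  grid_sets [set U | path_of U (i%:R / m%:R) = k].
Proof.
move=> m0 im; split; last first.
  exists m, [set h | h (inord i) = k]; split=> //; apply/seteqP; split => U /=;
  by rewrite /grid_trace inordK.
apply: sub_sigma_algebra; exists (i%:R/m%:R), k; split => //.
have m0' : 0 < m%:R :> R by rewrite ltr0n.
by rewrite divr_ge0//= ler_pdivrMr// mul1r ler_nat.
Qed.

(** The value at t < 1 is the eventual value at the grid points
    (floor(t m) + 1)/m, which tend to t from the right. *)
Lemma sigma_grid_sets : @measurable _ (jumps R) = <<s grid_sets >>.
Proof.
apply/seteqP; split; last first.
  by apply: smallest_sub; [exact: sigma_algebra_measurable|move=> C []].
apply: smallest_sub; first exact: smallest_sigma_algebra.
move=> _ [t [k [/andP[t0 t1] ->]]].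
case: (ltP t 1) => [{}t1|t1']; last first.
  have -> : t = 1%:R / 1%:R by rewrite divr1; apply/eqP; rewrite eq_le t1.
  by apply: sub_sigma_algebra; exact: grid_cylinder.
pose r m : R := (Num.truncn (t * m%:R)).+1%:R / m%:R.
have rP m : (0 < m)%N -> [/\ t <= r m, r m <= t + m%:R^-1 & ((Num.truncn (t * m%:R)).+1 <= m)%N].
  move=> m0; have m0' : 0 < m%:R :> R by rewrite ltr0n.
  have tm0 : 0 <= t * m%:R by rewrite mulr_ge0.
  have /andP[h1 h2] := truncn_itv tm0.
  rewrite /r; split.
  - by rewrite ler_pdivlMr// ltW.
  - by rewrite ler_pdivrMr// mulrDl mulVf ?gt_eqF// -natr1 lerD2r.
  - by rewrite -(ltr_nat R); apply: le_lt_trans h1 _; rewrite -[ltRHS]mul1r ltr_pM2r.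
have -> : [set U | path_of U t = k] =
    \bigcup_n \bigcap_m [set U | path_of U (r (n + m).+1) = k].
  apply/seteqP; split => U /=.
    move=> Uk; have [e e0 he] := path_of_right_cont U t.
    pose n := Num.truncn e^-1.
    exists n => // m _ /=; have [h1 h2 _] := rP (n + m).+1 isT.
    rewrite he//; apply: le_lt_trans h2 _; rewrite ltrD2l.
    rewrite invf_plt ?posrE ?ltr0n//; apply: lt_le_trans (truncnS_gt _) _.
    by rewrite ler_nat ltnS leq_addr.
  move=> [n _ hn]; have [e e0 he] := path_of_right_cont U t.
  pose m := Num.truncn e^-1.
  have [h1 h2 _] := rP (n + m).+1 isT.
  rewrite -(hn m I) /= he//; apply: le_lt_trans h2 _; rewrite ltrD2l.
  rewrite invf_plt ?posrE ?ltr0n//; apply: lt_le_trans (truncnS_gt _) _.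
  by rewrite ler_nat ltnS leq_addl.
pose J := g_sigma_algebraType grid_sets.
apply: (@bigcupT_measurable _ J) => n; apply: (@bigcapT_measurable _ J) => m.
by apply: sub_sigma_algebra; apply: grid_cylinder => //; have [] := rP (n + m).+1 isT.
Qed.

Lemma eq_measure_jumps (m1 m2 : {measure set (jumps R) -> \bar R}) :
  (m1 setT < +oo)%E -> (forall C, grid_sets C -> m1 C = m2 C) ->
  forall B, measurable B -> m1 B = m2 B.
Proof.
move=> fin1 h; apply: (measure_unique grid_sets (fun=> setT)) => //.
- exact: sigma_grid_sets.
- exact: grid_sets_setI.
- move=> _; split; first exact: measurableT.
  by exists 1%N, setT; split => //; rewrite preimage_setT.
- by rewrite bigcup_const//; exists 0%N.
Qed.
End Grid.

(** * Measure-theoretic tools *)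

Section Transfer.
Variable R : realType.
Local Open Scope ereal_scope.

(** The restriction of P to D gives no mass to the complement of D, so that
    integrating over everything or over D makes no difference. *)
Lemma ge0_integral_restr_push d d' (T : measurableType d) (Y : measurableType d')
    (P : {measure set T -> \bar R}) (D : set T) (mD : measurable D) (V : T -> Y)
    (mV : measurable_fun [set: T] V) (g : Y -> \bar R) :
  measurable_fun [set: Y] g -> (forall y, 0 <= g y) ->
  \int[pushforward (mrestr P mD) V]_y g y = \int[P]_(x in D) g (V x).
Proof.
move=> mg g0.
have mgV : measurable_fun [set: T] (g \o V) by exact: measurableT_comp.
rewrite ge0_integral_pushforward//= preimage_setT.
rewrite -(setUv D) ge0_integral_setU//=; last 3 first.
- exact: measurableC.
- by rewrite setUv.
- by rewrite disj_set2E setICr.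
rewrite [X in _ + X]null_set_integral ?adde0//=; last 3 first.
- exact: measurableC.
- exact: measurable_funTS.
- by rewrite /mrestr setICl measure0.
apply: eq_measure_integral => A mA AD /=.
by rewrite /mrestr setIidl.
Qed.

(** Two maps, considered on events D1 and D2, whose unnormalised laws are
    proportional: the integrals of a function of the maps are then proportional
    with the same constant.  This moves integrals between the space of
    configurations and the two underlying probability spaces. *)
Section proportional.
Variables (d d1 d2 : measure_display) (Y : measurableType d)
  (T1 : measurableType d1) (T2 : measurableType d2)
  (P : {measure set T1 -> \bar R}) (Q : {measure set T2 -> \bar R})
  (D1 : set T1) (D2 : set T2) (V1 : T1 -> Y) (V2 : T2 -> Y) (c : R).
Hypothesis (mD1 : measurable D1) (mD2 : measurable D2)
  (mV1 : measurable_fun [set: T1] V1) (mV2 : measurable_fun [set: T2] V2)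
  (c0 : (0 <= c)%R)
  (PQ : forall B, measurable B ->
    Q (D2 `&` V2 @^-1` B) = c%:E * P (D1 `&` V1 @^-1` B)).

Lemma ge0_integral_proportional (g : Y -> \bar R) :
  measurable_fun [set: Y] g -> (forall y, 0 <= g y) ->
  \int[Q]_(x in D2) g (V2 x) = c%:E * \int[P]_(x in D1) g (V1 x).
Proof.
move=> mg g0.
rewrite -(ge0_integral_restr_push Q mD2 mV2 mg g0).
rewrite -(ge0_integral_restr_push P mD1 mV1 mg g0).
pose m1 := pushforward (mrestr P mD1) V1.
rewrite -(ge0_integral_mscale m1 measurableT (NngNum c0) mg)//.
apply: eq_measure_integral => A mA _ /=.
by rewrite /mscale /= /pushforward /mrestr setIC PQ// setIC.
Qed.

Lemma integrable_proportional (f : Y -> R) :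
  measurable_fun [set: Y] f ->
  P.-integrable D1 (fun x => (f (V1 x))%:E) -> Q.-integrable D2 (fun x => (f (V2 x))%:E).
Proof.
move=> mf /integrableP[_ fi].
have mf' : measurable_fun [set: Y] (fun y => `|(f y)%:E|).
  by apply/measurableT_comp => //; exact/measurable_EFinP.
apply/integrableP; split.
  apply: measurable_funTS; apply/measurable_EFinP; exact: measurableT_comp.
rewrite (ge0_integral_proportional (g := fun y => `|(f y)%:E|))//.
by rewrite lte_mul_pinfty// lee_fin.
Qed.

Lemma Rintegral_proportional (f : Y -> R) :
  measurable_fun [set: Y] f -> P.-integrable D1 (fun x => (f (V1 x))%:E) ->
  Rintegral Q D2 (f \o V2) = (c * Rintegral P D1 (f \o V1))%R.
Proof.
move=> mf fi; have fi2 := integrable_proportional mf fi.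
have mE : measurable_fun [set: Y] (EFin \o f) by exact/measurable_EFinP.
rewrite /Rintegral /=.
rewrite [in LHS]integralE [in RHS]integralE.
have pE d0 (T0 : measurableType d0) (m : {measure set T0 -> \bar R}) D (V : T0 -> Y) :
    \int[m]_(x in D) (fun x => (f (V x))%:E)^\+ x = \int[m]_(x in D) ((EFin \o f)^\+ (V x)).
  by apply: eq_integral => x _; rewrite !funeposE.
have nE d0 (T0 : measurableType d0) (m : {measure set T0 -> \bar R}) D (V : T0 -> Y) :
    \int[m]_(x in D) (fun x => (f (V x))%:E)^\- x = \int[m]_(x in D) ((EFin \o f)^\- (V x)).
  by apply: eq_integral => x _; rewrite !funenegE.
have fp := integrable_pos_fin_num mD1 fi.
have fn := integrable_neg_fin_num mD1 fi.
rewrite !pE !nE in fp fn *.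
rewrite !ge0_integral_proportional//; [|exact: measurable_funeneg|exact: measurable_funepos].
rewrite -(fineK fp) -(fineK fn) -!EFinM -!EFinB /=.
by rewrite mulrBr.
Qed.
End proportional.
End Transfer.

Section Probability.
Variables (R : realType) (d : measure_display) (T : measurableType d)
  (P : probability T R).

Lemma ae_eq_measure (A B : set T) : measurable A -> measurable B ->
  {ae P, forall w, A w <-> B w} -> P A = P B.
Proof.
move=> mA mB AB.
have := @ae_eq_integral _ _ _ P setT (EFin \o \1_B) (EFin \o \1_A) measurableT.
rewrite !integral_indic// !setIT; apply; [exact/measurable_EFinP|exact/measurable_EFinP|].
apply: filterS AB => w AB _ /=; congr (_%:E); rewrite !indicE.
by congr ((nat_of_bool _)%:R); apply/idP/idP; rewrite !inE => /AB.
Qed.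

Lemma measure_finite_partition (K : finType) (S : pred K) (E : K -> set T) (D : set T) :
  measurable D -> (forall k, measurable (E k)) ->
  (forall k k' w, E k w -> E k' w -> k = k') ->
  {ae P, forall w, D w <-> exists2 k, S k & E k w} ->
  P D = (\sum_(k | S k) P (E k))%E.
Proof.
move=> mD mE dE DE.
have fS : finite_set [set` S] by exact: finite_finset.
have -> : P D = P (\bigcup_(k in [set` S]) E k).
  apply: ae_eq_measure.
  - exact: mD.
  - by apply: fin_bigcup_measurable => // k _.
  apply: filterS DE => w [DE ED]; split.
    by move=> /DE[k Sk Ekw]; exists k.
  by move=> [k Sk Ekw]; apply: ED; exists k.
rewrite measure_fin_bigcup//.
  rewrite -(@bigfs _ _ _ _ (index_enum K)) ?index_enum_uniq// => k _.
  by rewrite mem_index_enum.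
by move=> i j _ _ [w [iw jw]]; exact: dE iw jw.
Qed.

(** The set function is a measure only by virtue of the measurability of V, hence
    the existential form. *)
Lemma exists_restr_push d' (Y : measurableType d') (c : {nonneg R}) (D : set T)
    (V : {RV P >-> Y}) : measurable D ->
  exists mu : {measure set Y -> \bar R}, forall B, mu B = (c%:num%:E * P (D `&` V @^-1` B))%E.
Proof.
move=> mD; have mV : measurable_fun [set: T] V by exact: measurable_funP.
unshelve eexists (mscale c (pushforward (mrestr P mD) V)); first exact: mV.
by move=> B /=; rewrite /mscale /= /pushforward /mrestr setIC.
Qed.

Lemma independent_finType (I : finType) (F : I -> set (set T)) (A : I -> set T) :
  independent P F -> (forall i, F i (A i)) ->
  P [set w | forall i, A i w] = (\prod_i P (A i))%E.
Proof.
move=> ind FA; pose J := [fset i in enum I]%fset.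
have JI i : i \in J by rewrite !inE mem_enum.
have := ind J A (fun i _ => FA i).
have -> : (\prod_(i <- J) P (A i) = \prod_i P (A i))%E.
  rewrite -big_enum; apply: perm_big; apply: uniq_perm; rewrite ?fset_uniq ?enum_uniq//.
  by move=> i; rewrite JI mem_enum.
move=> <-; congr (P _); apply/seteqP; split => w /= h i => [_|]; first exact: h.
by apply: h; rewrite /= JI.
Qed.
End Probability.

Section DiscreteMeasurability.
Context d (T : measurableType d).

(** All sets of values are countable unions of single values, so that no
    measurable structure on the discrete types is involved. *)
Lemma measurable_discrete2 (A1 A2 : countType) (f1 : T -> A1) (f2 : T -> A2)
    (S : A1 -> A2 -> Prop) :
  (forall a, measurable (f1 @^-1` [set a])) ->
  (forall a, measurable (f2 @^-1` [set a])) ->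
  measurable [set w | S (f1 w) (f2 w)].
Proof.
move=> m1 m2.
have -> : [set w | S (f1 w) (f2 w)] = \bigcup_(p : A1 * A2)
    [set w | S p.1 p.2 /\ (f1 w = p.1 /\ f2 w = p.2)].
  apply/seteqP; split => w /=; first by move=> Sw; exists (f1 w, f2 w).
  by move=> [[a b] _ /= [Sab [-> ->]]].
apply: countable_bigcupT_measurable => [|p]; first exact: countableP.
have [Sp|nSp] := pselect (S p.1 p.2).
  rewrite (_ : mkset _ = f1 @^-1` [set p.1] `&` f2 @^-1` [set p.2]); first exact: measurableI.
  by apply/seteqP; split => w /= => [[]|].
by rewrite (_ : mkset _ = set0)//; apply/seteqP; split => w //= [].
Qed.

Lemma measurable_forall_fin (I : finType) (A : I -> set T) :
  (forall i, measurable (A i)) -> measurable [set w | forall i, A i w].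
Proof.
move=> mA; rewrite (_ : mkset _ = \bigcap_(i in [set: I]) A i).
  by apply: fin_bigcap_measurable => //; exact: finite_finset.
by apply/seteqP; split => w /= h i; [move=> _|]; exact: h.
Qed.

End DiscreteMeasurability.

Lemma g_sigma_algebra_preimage_set1 (T : pointedType) d (Y : measurableType d)
    (f : T -> Y) (B : set Y) :
  measurable B -> g_sigma_algebra_preimage f [set w | B (f w)].
Proof. by move=> mB; exists B => //; rewrite setTI. Qed.

Section Integrals.
Variables (R : realType) (d : measure_display) (T : measurableType d)
  (P : probability T R).
Local Open Scope ereal_scope.

Lemma integrable_finite_union (K : finType) (S : pred K) (E : K -> set T) (h : T -> R) :
  (forall k, measurable (E k)) -> measurable_fun [set: T] h ->
  (forall k k' w, E k w -> E k' w -> k = k') ->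
  (forall k, S k -> P.-integrable (E k) (EFin \o h)) ->
  P.-integrable (\bigcup_(k in [set` S]) E k) (EFin \o h) /\
  Rintegral P (\bigcup_(k in [set` S]) E k) h = (\sum_(k | S k) Rintegral P (E k) h)%R.
Proof.
move=> mE mh dE iE.
have mh' : measurable_fun [set: T] (EFin \o h) by exact/measurable_EFinP.
pose s := [seq k <- index_enum K | S k].
have us : uniq s by rewrite filter_uniq// index_enum_uniq.
have trE : trivIset [set` s] E by move=> i j _ _ [w [iw jw]]; exact: dE iw jw.
have sS k : (k \in s) = S k by rewrite mem_filter mem_index_enum andbT.
have -> : \bigcup_(k in [set` S]) E k = \big[setU/set0]_(k <- s) E k.
  rewrite (_ : [set` S] = [set` s]) ?bigcup_seq//.
  by apply/seteqP; split => k /=; rewrite sS.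
have mU : measurable (\big[setU/set0]_(k <- s) E k) by exact: bigsetU_measurable.
split.
  apply/integrableP; split; first exact: measurable_funTS.
  rewrite ge0_integral_bigsetU//; last first.
    by apply: measurable_funTS; exact: measurableT_comp.
  rewrite big_seq; apply: lte_sum_pinfty => k; rewrite sS => Sk.
  by have /integrableP[] := iE k Sk.
rewrite /Rintegral integral_bigsetU_EFin//; last exact: measurable_funTS.
rewrite big_filter sum_fine// => k Sk.
exact: integrable_fin_num (iE k Sk).
Qed.

Lemma Rintegral_ae_bound (D : set T) (h b : T -> R) (K : R) :
  measurable D -> measurable_fun [set: T] h -> measurable_fun [set: T] b ->
  (forall w, 0 <= b w)%R ->
  {ae P, forall w, D w -> (`|h w| <= b w)%R} ->
  \int[P]_(w in D) (b w)%:E <= K%:E ->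
  P.-integrable D (EFin \o h) /\ (`|Rintegral P D h| <= K)%R.
Proof.
move=> mD mh mb b0 hb bK.
have mh' : measurable_fun [set: T] (EFin \o h) by exact/measurable_EFinP.
have hK : \int[P]_(w in D) `|(h w)%:E| <= K%:E.
  apply: le_trans bK; apply: ae_ge0_le_integral => //.
  - by apply: measurable_funTS; exact: measurableT_comp.
  - by move=> w _; rewrite lee_fin.
  - by apply: measurable_funTS; exact/measurable_EFinP.
have ih : P.-integrable D (EFin \o h).
  apply/integrableP; split; first exact: measurable_funTS.
  exact: le_lt_trans hK (ltry _).
split=> //; apply: le_trans (le_normr_Rintegral mD ih) _.
rewrite -lee_fin; apply: le_trans hK.
rewrite /Rintegral fineK//; apply: integrable_fin_num => //.
exact: integrable_abse ih.
Qed.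

(** The expectation is the series over the level sets of c, bounded through its
    partial sums. *)
Lemma integral_nat_le (D : set T) (c : T -> nat) (u : nat -> R) (K : R) :
  measurable D -> (forall n, measurable (c @^-1` [set n])) ->
  (forall n, P (D `&` c @^-1` [set n]) * n%:R%:E <= (u n)%:E) ->
  (forall k, \sum_(n < k) u n <= K)%R ->
  \int[P]_(w in D) (c w)%:R%:E <= K%:E.
Proof.
move=> mD mc hu hK.
have -> : D = \bigcup_n (D `&` c @^-1` [set n]).
  by apply/seteqP; split => w /=; [move=> Dw; exists (c w)|move=> [n _ []]].
have mcR : measurable_fun [set: T] (fun w => (c w)%:R%:E : \bar R).
  have mc' : measurable_fun [set: T] c.
    move=> _ B _; rewrite setTI (_ : c @^-1` B = [set w | B (c w) /\ True])//.
    by apply: (@measurable_discrete2 _ T nat nat c c (fun x _ => B x /\ True)).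
    by apply/seteqP; split => w //= [].
  apply: (measurableT_comp (f := fun n : nat => n%:R%:E : \bar R)) mc'.
  by move=> _ B _.
rewrite ge0_integral_bigcup//; last 3 first.
- by move=> n; exact: measurableI.
- exact: measurable_funTS.
- by move=> i j _ _ [w [[_ /= <-] [_ /= <-]]].
apply: lime_le.
  by apply: is_cvg_nneseries => n _ _; apply: integral_ge0 => w _; rewrite lee_fin.
apply: nearW => k; apply: (@le_trans _ _ (\sum_(0 <= n < k) (u n)%:E)).
  apply: lee_sum => n _.
  rewrite (eq_integral (fun=> n%:R%:E)); last by move=> w; rewrite inE => -[_ /= ->].
  rewrite integral_cst; last exact: measurableI.
  by rewrite muleC; exact: hu.
by rewrite sumEFin lee_fin big_mkord; exact: hK.
Qed.
End Integrals.

(** * Grid configurations with at most one jump per cell *)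

Section Configurations.
Variables N m : nat.
Implicit Types (v : {ffun 'I_N -> option bool})
  (k : {ffun 'I_N -> option (bool * 'I_m)}).

(** Each cell j carries at most one jump: v j is its sign, with true for an
    up-jump, and None means that there is no jump.  In a configuration k, the sign
    comes with the index l of the subcell, among the m subcells of equal length,
    which contains the jump. *)
Definition jump_count n (v : {ffun 'I_n -> option bool}) (b : bool) : nat :=
  #|[pred j | v j == Some b]|.

Definition config_signs k : {ffun 'I_N -> option bool} := [ffun j => omap fst (k j)].

(** The number of jumps of sign b in the subcell of global index i; the subcell l
    of the cell j has the global index j m + l. *)
Definition config_incr k (b : bool) (i : nat) : nat :=
  \sum_(j < N) (if k j is Some (c, l) then (c == b) && (j * m + l == i)%N else false).

(** The position of the path at the grid time p/(N m). *)
Definition config_path k (p : nat) : int :=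
  \sum_(j < N) (if k j is Some (c, l) then
     if (j * m + l < p)%N then (if c then 1 else -1) else 0 else 0).

Lemma cell_index_lt (j : 'I_N) (l : 'I_m) : (j * m + l < N * m)%N.
Proof.
apply: (@leq_trans (j.+1 * m)); last by rewrite leq_mul2r ltn_ord orbT.
by rewrite mulSn addnC ltn_add2r.
Qed.

Lemma config_incrE k b (j : 'I_N) (l : 'I_m) :
  config_incr k b (j * m + l) = (k j == Some (b, l)).
Proof.
rewrite /config_incr (bigD1 j)//= big1 ?addn0; last first.
  move=> i ij; case: (k i) => [[c l']|]//.
  apply/eqP; rewrite eqb0; apply: contra ij => /andP[_ /eqP e].
  apply/eqP/val_inj => /=.
  have m0 : (0 < m)%N by apply: leq_trans (ltn_ord l).
  have := congr1 (divn^~ m) e.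
  by rewrite !divnMDl// !divn_small// !addn0.
case: (k j) => [[c l']|]//=; congr nat_of_bool.
by rewrite eqn_add2l (inj_eq Some_inj) xpair_eqE.
Qed.

Lemma sum_config_incr k b p :
  (\sum_(i < p) config_incr k b i)%N =
  (\sum_(j < N) (if k j is Some (c, l) then (c == b) && (j * m + l < p)%N else false))%N.
Proof.
rewrite /config_incr exchange_big /=; apply: eq_bigr => j _.
case: (k j) => [[c l]|]; last by rewrite big1.
case: eqP => _ /=; last by rewrite big1.
case: ltnP => lt.
  rewrite (bigD1 (Ordinal lt))//= eqxx big1// => i.
  by rewrite -val_eqE /= eq_sym => /negbTE ->.
by rewrite big1// => i _; case: eqP => // e; have := ltn_ord i; rewrite -e ltnNge lt.
Qed.

Lemma config_pathE k p : config_path k p =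
  (\sum_(i < p) config_incr k true i)%N%:Z - (\sum_(i < p) config_incr k false i)%N%:Z.
Proof.
rewrite !sum_config_incr /config_path -!natz !natr_sum -sumrB.
apply: eq_bigr => j _; case: (k j) => [[[] l]|]; rewrite ?subrr//=.
  by case: ltnP; rewrite ?subr0.
by case: ltnP; rewrite ?sub0r.
Qed.

Lemma sum_config_incr_all k b :
  (\sum_(i < N * m) config_incr k b i)%N = jump_count (config_signs k) b.
Proof.
rewrite sum_config_incr /jump_count -sum1_card [RHS]big_mkcond /=.
apply: eq_bigr => j _; rewrite inE ffunE.
case: (k j) => [[c l]|]//=.
rewrite cell_index_lt.
by rewrite andbT; case: (c == b) / eqP => [->|e]; [rewrite eqxx|case: eqP => // -[]].
Qed.

Lemma config_incr_inj k k' :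
  (forall b (i : 'I_(N * m)), config_incr k b i = config_incr k' b i) -> k = k'.
Proof.
move=> h; apply/ffunP => j.
have lt := cell_index_lt j.
have e b l : (k j == Some (b, l)) = (k' j == Some (b, l)).
  by have := h b (Ordinal (lt l)); rewrite /= !config_incrE; do 2 case: (_ == _).
case Ek : (k j) => [[b l]|].
  by apply/esym/eqP; rewrite -e Ek.
case Ek' : (k' j) => [[b l]|]//.
by have := e b l; rewrite Ek Ek' eqxx.
Qed.

(** If the increments over each cell add up to those of a sign vector, then the
    unit increment of every nonempty cell sits in exactly one of its subcells,
    which determines a configuration. *)
Lemma exists_config v (D : bool -> nat -> nat) :
  (forall b (j : 'I_N), (\sum_(l < m) D b (j * m + l))%N = (v j == Some b)) <->
  exists2 k, config_signs k = v & forall b (i : 'I_(N * m)), D b i = config_incr k b i.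
Proof.
split=> [h|[k <- h] b j]; last first.
  have lt := cell_index_lt j.
  under eq_bigr => l _ do rewrite (h b (Ordinal (lt l))) /= config_incrE.
  rewrite ffunE; case: (k j) => [[c l]|]/=; last by rewrite big1.
  case: (eqVneq c b) => [->|cb]; last first.
    rewrite big1 => [|i _]; first by case: eqP => // -[] /eqP; rewrite (negbTE cb).
    by apply/eqP; rewrite eqb0; apply: contra cb => /eqP[->].
  rewrite eqxx (bigD1 l)//= eqxx big1// => i il.
  by apply/eqP; rewrite eqb0; apply: contra il => /eqP[->].
pose k : {ffun 'I_N -> option (bool * 'I_m)} := [ffun j : 'I_N => if v j is Some b then
  omap (fun l => (b, l)) [pick l : 'I_m | D b (j * m + l)%N != 0%N] else None].
have D1 b (j : 'I_N) (l : 'I_m) : D b (j * m + l)%N = (k j == Some (b, l)).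
  have hb := h b j; rewrite (bigD1 l)//= in hb.
  rewrite ffunE; case vj : (v j) hb => [c|]/=; last by case: (D _ _).
  case: (eqVneq c b) vj => [->{c}|cb] vj; last first.
    have -> : (Some c == Some b) = false by apply/eqP => -[] /eqP; rewrite (negbTE cb).
    move/eqP; rewrite addn_eq0 => /andP[/eqP -> _]; case: pickP => [l'|]//= _.
    by apply/esym/eqP; rewrite eqb0; apply: contra cb => /eqP[->].
  rewrite eqxx; case: pickP => [l' Dl'|Dn] /=.
    move=> hb.
    case: (eqVneq l' l) Dl' => [->|ll'] Dl'.
      by rewrite eqxx; move: hb Dl'; case: (D _ _) => // -[].
    have -> : (Some (b, l') == Some (b, l)) = false.
      by apply/eqP => -[] /eqP; rewrite (negbTE ll').
    move: hb; rewrite (bigD1 l')//=; move: Dl'.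
    case: (D b (j * m + l')%N) => // a _.
    by case: (D _ _) => // c; rewrite addSn addnS.
  by move=> hb; have /negPn/eqP := negbT (Dn l).
exists k.
  apply/ffunP => j; rewrite !ffunE.
  case vj : (v j) => [b|]//=; case: pickP => //= Dn.
  have := h b j; rewrite vj eqxx big1// => l _; by have /negPn/eqP := negbT (Dn l).
move=> b i.
have m0 : (0 < m)%N by case: m i => [|//]; rewrite muln0 => -[].
have lj : (i %/ m < N)%N by rewrite ltn_divLR.
have ll : (i %% m < m)%N by rewrite ltn_mod.
have := D1 b (Ordinal lj) (Ordinal ll).
have := config_incrE k b (Ordinal lj) (Ordinal ll).
by rewrite /= -divn_eq => -> ->.
Qed.

End Configurations.

(** * The random walk on a grid *)

Section Walk.
Variables (R : realType) (d : measure_display) (T : measurableType d)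
  (P : probability T R) (C : bool -> R -> {RV P >-> nat}).
Hypothesis (rateC : forall b, rate1_poisson_process (C b))
  (indC : independent P (fun b => process_sigma_algebra (C b))).
Implicit Types (b : bool) (t : R).

Lemma measurable_count b t a : measurable (C b t @^-1` [set a]).
Proof. by rewrite -[X in measurable X]setTI; exact: measurable_funP. Qed.

(** A statement about finitely many values of one process lies in its
    sigma-algebra; the members of the latter are viewed as the measurable sets of
    a type of their own, so that the general closure lemmas apply. *)
Lemma process_increments_measurable b (I : finType) (s t : I -> R) (a : I -> nat) :
  (forall i, 0 <= s i) -> (forall i, 0 <= t i) ->
  process_sigma_algebra (C b) [set w | forall i, (C b (t i) w - C b (s i) w)%N = a i].
Proof.
move=> s0 t0.
pose J := g_sigma_algebraType (\bigcup_(t in `[0, +oo[) g_sigma_algebra_preimage (C b t)).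
have mJ u x : 0 <= u -> @measurable _ J (C b u @^-1` [set x]).
  move=> u0; apply: sub_sigma_algebra; exists u; first by rewrite /= in_itv /= u0.
  by rewrite /preimage; apply: (g_sigma_algebra_preimage_set1 (C b u) (B := [set x])).
apply: (@measurable_forall_fin _ J) => i.
by apply: (@measurable_discrete2 _ J _ _ (C b (t i)) (C b (s i)) (fun x y => (x - y)%N = a i)) => x;
  exact: mJ.
Qed.

Lemma prob_both_processes (A : bool -> set T) :
  (forall b, process_sigma_algebra (C b) (A b)) ->
  P [set w | forall b, A b w] = (P (A true) * P (A false))%E.
Proof.
move=> hA; rewrite (independent_finType indC hA).
by rewrite (bigD1 true)//= (bigD1 false)//= big_pred0 ?mule1// => -[].
Qed.

Lemma prob_increments b (M : nat) (t : nat -> R) (a : 'I_M -> nat) :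
  0 <= t 0%N -> (forall i, t i < t i.+1) ->
  P [set w | forall i : 'I_M, (C b (t i.+1) w - C b (t i) w)%N = a i] =
  (\prod_(i < M) poisson_pmf (t i.+1 - t i) (a i))%:E.
Proof.
move=> t0 tS; have [_ _ _ hp hi] := rateC b.
have t_ge0 i : 0 <= t i by elim: i => // i IH; exact: le_trans IH (ltW (tS i)).
have := independent_finType (hi M t t0 (fun i => ltW (tS i)))
  (A := fun i : 'I_M => [set w | (C b (t i.+1) w - C b (t i) w)%N = a i]).
move=> -> => [|i]; last exact: (g_sigma_algebra_preimage_set1 _ (B := [set a i])).
by rewrite -prodEFin; apply: eq_bigr => i _; rewrite hp.
Qed.

Lemma prob_end_counts n : P [set w | C true 1 w = n /\ C false 1 w = n] =
  (expR (-2) / (n`!%:R ^+ 2))%:E.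
Proof.
have C0 b w : C b 0 w = 0%N by have [] := rateC b.
have -> : [set w | C true 1 w = n /\ C false 1 w = n] =
    [set w | forall b, [set w | forall i : 'I_1, (C b 1 w - C b 0 w)%N = n] w].
  apply/seteqP; split => w /=.
    by move=> [h1 h2] [] _; rewrite C0 subn0.
  by move=> h; have := h true ord0; have := h false ord0; rewrite !C0 !subn0.
rewrite prob_both_processes; last first.
  by move=> b; apply: (@process_increments_measurable b 'I_1 (fun=> 0) (fun=> 1) (fun=> n)).
have E b : P [set w | forall i : 'I_1, (C b 1 w - C b 0 w)%N = n] = (expR (-1) / n`!%:R)%:E.
  have [_ _ _ hp _] := rateC b.
  rewrite (_ : mkset _ = [set w | (C b 1 w - C b 0 w)%N = n]).
    by rewrite hp//= /poisson_pmf subr0 ltr01 expr1n mul1r mulrC.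
  by apply/seteqP; split => w /= h //; exact: h ord0.
rewrite !E -EFinM; congr (_%:E).
rewrite (_ : -2 = -1 + -1 :> R); last by ring.
by rewrite expRD expr2 invfM; ring.
Qed.

Lemma count_homo (M : nat) w b : {homo (fun i : nat => C b (i%:R / M%:R) w) : x y / (x <= y)%N}.
Proof.
move=> x y xy; have [_ + _ _ _] := rateC b; apply; first by rewrite divr_ge0.
by rewrite ler_wpM2r ?invr_ge0// ler_nat.
Qed.

Section Scheme.
Variables (N m : nat).
Hypothesis (N0 : (0 < N)%N) (m0 : (0 < m)%N).
Let M := (N * m)%N.
Implicit Types k : {ffun 'I_N -> option (bool * 'I_m)}.

Definition walk_config k : set T := [set w | forall b, [set w | forall i : 'I_(N * m),
  (C b (i.+1%:R / (N * m)%:R) w - C b (i%:R / (N * m)%:R) w)%N = config_incr k b i] w].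

Definition walk_signs (v : {ffun 'I_N -> option bool}) : set T :=
  [set w | forall b (j : 'I_N),
    (C b (j.+1%:R / N%:R) w - C b (j%:R / N%:R) w)%N = (v j == Some b)].

Let M0 : (0 < M)%N. Proof. by rewrite muln_gt0 N0. Qed.
Let M0r : 0 < M%:R :> R. Proof. by rewrite ltr0n. Qed.

Lemma measurable_walk_config k : measurable (walk_config k).
Proof.
apply: measurable_forall_fin => b; apply: measurable_forall_fin => i.
apply: (@measurable_discrete2 _ _ _ _ (C b _) (C b _) (fun x y => (x - y)%N = _)) => x;
  exact: measurable_count.
Qed.

Lemma measurable_walk_signs v : measurable (walk_signs v).
Proof.
apply: measurable_forall_fin => b; apply: measurable_forall_fin => j.
apply: (@measurable_discrete2 _ _ _ _ (C b _) (C b _) (fun x y => (x - y)%N = _)) => x;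
  exact: measurable_count.
Qed.

Lemma walk_config_disjoint k k' w : walk_config k w -> walk_config k' w -> k = k'.
Proof.
move=> h h'; apply: config_incr_inj => b i.
by rewrite -(h b i) -(h' b i).
Qed.

Lemma walk_signs_count v w b : walk_signs v w -> C b 1 w = jump_count v b.
Proof.
move=> hv; have C0 : C b 0 w = 0%N by have [] := rateC b.
have := telescope_sumn 0 N (@count_homo N w b).
rewrite mul0r C0 subn0 divff ?pnatr_eq0 -?lt0n// => <-.
rewrite big_mkord /jump_count -sum1_card [RHS]big_mkcond /=.
by apply: eq_bigr => j _; rewrite (hv b j) inE; case: (_ == _).
Qed.

Lemma walk_signs_config v w :
  walk_signs v w <-> exists2 k, config_signs k = v & walk_config k w.
Proof.
have E b (j : 'I_N) : (\sum_(l < m) (C b ((j * m + l).+1%:R / M%:R) w -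
    C b ((j * m + l)%:R / M%:R) w) = C b (j.+1%:R / N%:R) w - C b (j%:R / N%:R) w)%N.
  have lam (i : nat) : i%:R / N%:R = (i * m)%:R / M%:R :> R.
    by rewrite /M !natrM -mulf_div divff ?mulr1// pnatr_eq0 -lt0n.
  rewrite !lam mulSn addnC.
  rewrite -(telescope_sumn (j * m) (j * m + m) (@count_homo M w b)).
  rewrite -[X in (\sum_(X <= _ < _) _)%N]add0n big_addn addKn big_mkord.
  by apply: eq_bigr => l _; rewrite addnC.
have [h1 h2] := @exists_config N m v (fun b i => (C b (i.+1%:R / M%:R) w - C b (i%:R / M%:R) w)%N).
split.
  by move=> hv; apply: h1 => b j; rewrite E; exact: hv.
move=> [k kv hk] b j; rewrite -E; apply: h2 => //; exists k => //.
Qed.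

Lemma walk_config_path k w (p : nat) : walk_config k w -> (p <= M)%N ->
  (C true (p%:R / M%:R) w)%:Z - (C false (p%:R / M%:R) w)%:Z = config_path k p.
Proof.
move=> hk pM; rewrite config_pathE.
have E b : C b (p%:R / M%:R) w = (\sum_(i < p) config_incr k b i)%N.
  transitivity (\sum_(0 <= i < p) (C b (i.+1%:R / M%:R) w - C b (i%:R / M%:R) w))%N.
    rewrite (telescope_sumn 0 p (@count_homo M w b)) mul0r.
    by have [-> _ _ _ _] := rateC b; rewrite subn0.
  rewrite big_mkord; apply: eq_bigr => i _.
  exact: (hk b (Ordinal (leq_trans (ltn_ord i) pM))).
by rewrite !E.
Qed.

(** A subcell of length 1/M contributes exp(-1/M) for each of the two processes,
    and a further factor 1/M if it contains a jump. *)
Lemma prob_walk_config k : P (walk_config k) =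
  (expR (-2) * (M%:R^-1) ^+
    (jump_count (config_signs k) true + jump_count (config_signs k) false))%:E.
Proof.
rewrite prob_both_processes; last first.
  by move=> b; apply: (@process_increments_measurable b 'I_(N * m) (fun i => i%:R / (N * m)%:R)
    (fun i => i.+1%:R / (N * m)%:R) (fun i => config_incr k b i)) => i; rewrite divr_ge0.
have E b : P [set w | forall i : 'I_(N * m),
  (C b (i.+1%:R / (N * m)%:R) w - C b (i%:R / (N * m)%:R) w)%N = config_incr k b i] =
  (expR (-1) * (M%:R^-1) ^+ (jump_count (config_signs k) b))%:E.
  rewrite (@prob_increments b (N * m) (fun i => i%:R / (N * m)%:R) (fun i => config_incr k b i)).
  congr (_%:E).
  transitivity (\prod_(i < M) (expR (- M%:R^-1) * M%:R^-1 ^+ config_incr k b i) : R).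
    apply: eq_bigr => i _.
    rewrite -mulrBl -natrB// subSnn mul1r /poisson_pmf invr_gt0 M0r mulrC; congr *%R.
    have : (config_incr k b i <= 1)%N.
      have lj : (i %/ m < N)%N by rewrite ltn_divLR.
      have ll : (i %% m < m)%N by rewrite ltn_mod.
      have := config_incrE k b (Ordinal lj) (Ordinal ll).
      by rewrite /= -divn_eq => ->; exact: leq_b1.
    by rewrite /=; case: (config_incr k b i) => [|[|]]//= _; rewrite invr1 mulr1.
  rewrite big_split /= prodr_const card_ord -expRM_natl; congr (expR _ * _).
    by rewrite mulrN divff ?gt_eqF.
  by rewrite prodrXr; congr (_ ^+ _); exact: sum_config_incr_all.
- by rewrite mul0r.
- by move=> i; rewrite ltr_pM2r ?invr_gt0// ltr_nat.
rewrite !E -EFinM exprD (_ : -2 = -1 + -1 :> R); last by ring.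
by rewrite expRD mulrACA.
Qed.
End Scheme.
End Walk.

(** * The approximation scheme on a grid *)

Lemma uniform_prob_oc (R : realType) (a b : R) (ab : a < b) (s t : R) :
  a <= s -> s <= t -> t <= b ->
  uniform_prob ab `]s, t]%classic = ((t - s) / (b - a))%:E.
Proof.
move=> as_ st tb; rewrite /uniform_prob.
rewrite (eq_integral (fun=> ((b - a)^-1)%:E)); last first.
  move=> x; rewrite inE /= in_itv /= => /andP[sx xt]; rewrite /uniform_pdf.
  by rewrite (le_trans as_ (ltW sx)) (le_trans xt tb).
rewrite integral_cst//= lebesgue_measure_itv/= lte_fin.
case: ltP => [_|ts]; first by rewrite -EFinB -EFinM mulrC.
by rewrite mule0 (@le_anti _ _ s t) ?subrr ?mul0r// st ts.
Qed.

Definition sign_val (o : option bool) : int :=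
  match o with Some true => 1 | Some false => -1 | None => 0 end.

Lemma sign_val_inj : injective sign_val.
Proof. by move=> [[]|] [[]|]. Qed.

Section Scheme.
Variables (R : realType) (d : measure_display) (T : measurableType d)
  (Q : probability T R) (N : nat)
  (xi : 'I_N -> {RV Q >-> int}) (tau : 'I_N -> {RV Q >-> R}).
Hypothesis (hN : (2 <= N)%N) (hQ : approximation_scheme xi tau).

Let N0 : (0 < N%:R :> R). Proof. by rewrite ltr0n (leq_trans _ hN). Qed.

Lemma measurable_xi j a : measurable (xi j @^-1` [set a]).
Proof. by rewrite -[X in measurable X]setTI; exact: measurable_funP. Qed.

Lemma measurable_tau j (B : set R) : measurable B -> measurable [set w | B (tau j w)].
Proof.
by move=> mB; rewrite -[X in measurable X]setTI; exact: (measurable_funP (tau j)).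
Qed.

Definition scheme_signs (v : {ffun 'I_N -> option bool}) : set T :=
  [set w | forall j, xi j w = sign_val (v j)].

Lemma measurable_scheme_signs v : measurable (scheme_signs v).
Proof. by apply: measurable_forall_fin => j; exact: measurable_xi. Qed.

Lemma prob_xi j o : Q [set w | xi j w = sign_val o] =
  (if o is Some _ then N%:R^-1 else 1 - 2 / N%:R)%:E.
Proof. by have [_ /(_ j)[h1 h2 h3] _] := hQ; case: o => [[]|]. Qed.

Lemma prob_tau j (B : set R) : measurable B ->
  Q [set w | B (tau j w)] = uniform_prob (cell_lt R j) B.
Proof. by have [_ _ h] := hQ => mB; rewrite -h. Qed.

(** The probabilities of the values 1, -1 and 0 add up to 1, and the left end of
    a cell is a null set for the uniform law. *)
Lemma ae_scheme_nondegenerate : {ae Q, forall w, (exists v, scheme_signs v w) /\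
  forall j : 'I_N, j%:R / N%:R < tau j w <= j.+1%:R / N%:R}.
Proof.
have h1 (j : 'I_N) : {ae Q, forall w, exists o, xi j w = sign_val o}.
  pose A := [set w | exists o, xi j w = sign_val o].
  have mA : measurable A.
    rewrite (_ : A = \bigcup_o (xi j @^-1` [set sign_val o])).
      apply: countable_bigcupT_measurable => [|u]; [exact: countableP|exact: measurable_xi].
    by apply/seteqP; split => w /= [u]; exists u.
  have QA : Q A = 1%E.
    rewrite (@measure_finite_partition _ _ _ Q _ xpredT (fun o => [set w | xi j w = sign_val o]))//.
    - under eq_bigr do rewrite prob_xi.
      rewrite sumEFin (bigD1 None)//= (bigD1 (Some true))//= (bigD1 (Some false))//= big_pred0.
        by congr (_%:E); field; rewrite gt_eqF.
      by case => [[]|].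
    - by move=> o; exact: measurable_xi.
    - by move=> o o' w /= -> /sign_val_inj.
    - by apply: aeW => w; split => [[u ?]|[u _ ?]]; exists u.
  exists (~` A); split => //; first exact: measurableC.
  by rewrite probability_setC// QA subee.
have h2 (j : 'I_N) : {ae Q, forall w, j%:R / N%:R < tau j w <= j.+1%:R / N%:R}.
  pose A := [set w | `]j%:R / N%:R, j.+1%:R / N%:R]%classic (tau j w)].
  have mA : measurable A.
    exact: measurable_tau.
  have QA : Q A = 1%E.
    rewrite prob_tau// uniform_prob_oc//; last exact/ltW/cell_lt.
    by rewrite divff// subr_eq0 gt_eqF// cell_lt.
  exists (~` A); split; [exact: measurableC| |].
    by rewrite probability_setC// QA subee.
  by move=> w /=; rewrite /A /= in_itv.
have all_fin (p : 'I_N -> T -> Prop) : (forall j, {ae Q, forall w, p j w}) ->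
    {ae Q, forall w, forall j, p j w}.
  move=> h; have := @ae_foralln _ _ _ Q (fun n w => forall j : 'I_N, val j = n -> p j w).
  have h' n : \forall w \ae Q, forall j : 'I_N, val j = n -> p j w.
    case: (ltnP n N) => nN; last first.
      by apply: aeW => w j jn; move: (ltn_ord j); rewrite /= jn ltnNge nN.
    by apply: filterS (h (Ordinal nN)) => w pw j jn; rewrite (_ : j = Ordinal nN)//; exact: val_inj.
  by move=> /(_ h'); apply: filterS => w H j; exact: H.
apply: filterS (filterI (all_fin _ h1) (all_fin _ h2)) => w [hx ht]; split => //.
have [f hf] := choice hx.
by exists [ffun j => f j] => j; rewrite ffunE.
Qed.

Section Level.
Variables (m : nat).
Hypothesis (m0 : (0 < m)%N).
Let M := (N * m)%N.
Let M0r : 0 < M%:R :> R. Proof. by rewrite ltr0n muln_gt0 m0 (leq_trans _ hN). Qed.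
Implicit Types k : {ffun 'I_N -> option (bool * 'I_m)}.

Definition time_set (j : 'I_N) (o : option (bool * 'I_m)) : set R :=
  if o is Some (_, l) then `](j * m + l)%:R / M%:R, (j * m + l).+1%:R / M%:R]%classic
  else setT.

Definition scheme_config k : set T := [set w | forall j,
  xi j w = sign_val (config_signs k j) /\ time_set j (k j) (tau j w)].

Lemma measurable_time_set j o : measurable (time_set j o).
Proof. by case: o => [[c l]|]; [exact: measurable_itv|exact: measurableT]. Qed.

Lemma measurable_scheme_config k : measurable (scheme_config k).
Proof.
apply: measurable_forall_fin => j; apply: measurableI; first exact: measurable_xi.
by apply: measurable_tau; exact: measurable_time_set.
Qed.

Lemma scheme_config_disjoint k k' w : scheme_config k w -> scheme_config k' w -> k = k'.
Proof.
move=> h h'; apply/ffunP => j; have [x1 t1] := h j; have [x2 t2] := h' j.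
have : config_signs k j = config_signs k' j by apply: sign_val_inj; rewrite -x1.
rewrite !ffunE; move: t1 t2; case: (k j) (k' j) => [[c l]|] [[c' l']|]//=.
rewrite !in_itv /= => /andP[a1 a2] /andP[b1 b2] [<-].
have := lt_le_trans a1 b2; have := lt_le_trans b1 a2.
rewrite !ltr_pM2r ?invr_gt0// !ltr_nat !ltnS !leq_add2l => h1 h2.
by congr (Some (_, _)); apply/val_inj/eqP; rewrite eqn_leq /= h1 h2.
Qed.

(** The subcell of a time is determined by the first grid point which is not
    smaller; cells without a jump impose no condition on their time. *)
Lemma ae_scheme_signs_config v : {ae Q, forall w,
  scheme_signs v w <-> exists2 k, config_signs k = v & scheme_config k w}.
Proof.
apply: filterS ae_scheme_nondegenerate => w [_ ht]; split; last first.
  by move=> [k <- hk] j; have [] := hk j.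
move=> hv.
have hl (j : 'I_N) : exists l : 'I_m,
    `](j * m + l)%:R / M%:R, (j * m + l).+1%:R / M%:R]%classic (tau j w).
  have /andP[t1 t2] := ht j.
  pose x := tau j w * M%:R.
  have x1 : (j * m)%:R < x.
    rewrite /x /M natrM natrM mulrA ltr_pM2r ?ltr0n//.
    by rewrite -ltr_pdivrMr.
  have x2 : x <= (j.+1 * m)%:R.
    by rewrite /x /M natrM natrM mulrA ler_pM2r ?ltr0n// -ler_pdivlMr.
  have cx : exists n, x <= (j * m + n).+1%:R.
    exists (m.-1); apply: le_trans x2 _.
    by rewrite -addnS prednK// mulSn addnC.
  case: (ex_minnP cx) => n0 xn nmin.
  have n0m : (n0 < m)%N.
    have := nmin m.-1; rewrite -addnS prednK// addnC -mulSn => /(_ x2).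
    by move=> h; apply: leq_ltn_trans h _; rewrite prednK.
  exists (Ordinal n0m); rewrite /= in_itv /=.
  rewrite ltr_pdivrMr// ler_pdivlMr// -/x xn andbT.
  case: n0 nmin {xn n0m} => [|n0] nmin; first by rewrite addn0.
  rewrite ltNge; apply/negP => h.
  by have := nmin n0; rewrite -addnS => /(_ h); rewrite ltnn.
have [f hf] := choice hl.
exists [ffun j => omap (fun b => (b, f j)) (v j)].
  by apply/ffunP => j; rewrite !ffunE; case: (v j).
move=> j; rewrite !ffunE; split; first by rewrite hv; case: (v j).
by case: (v j) => [b|] /=; [exact: hf|].
Qed.

Lemma scheme_config_path k w (p : nat) : scheme_config k w ->
  scheme_path xi tau (p%:R / M%:R) w = config_path k p.
Proof.
move=> hk; rewrite /scheme_path /config_path big_mkcond /=.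
apply: eq_bigr => j _; have [-> ht] := hk j; move: ht; rewrite ffunE.
case: (k j) => [[c l]|] /=; last by case: ifP.
rewrite in_itv /= => /andP[t1 t2].
case: ltnP => lp.
  rewrite (le_trans t2); first by case: c.
  by rewrite ler_pM2r ?invr_gt0// ler_nat.
rewrite leNgt (le_lt_trans _ t1)//.
by rewrite ler_pM2r ?invr_gt0// ler_nat.
Qed.

(** A nonempty cell contributes 1/N for its sign and 1/m for the subcell of its
    time, an empty cell contributes 1 - 2/N. *)
Lemma prob_scheme_config k : Q (scheme_config k) =
  ((1 - 2 / N%:R) ^+ (N - (jump_count (config_signs k) true + jump_count (config_signs k) false))
   * (M%:R^-1) ^+ (jump_count (config_signs k) true + jump_count (config_signs k) false))%:E.
Proof.
have [ind _ _] := hQ.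
have -> : scheme_config k = [set w | forall i : 'I_N + 'I_N,
   match i with inl j => [set w | [set sign_val (config_signs k j)] (xi j w)]
   | inr j => [set w | time_set j (k j) (tau j w)] end w].
  apply/seteqP; split => w /= h; first by move=> [j|j]; have [] := h j.
  by move=> j; split; [exact: (h (inl j))|exact: (h (inr j))].
rewrite (independent_finType ind); last first.
  by move=> [j|j]; apply: g_sigma_algebra_preimage_set1; [|exact: measurable_time_set].
rewrite big_sumType /= -big_split /=.
set n := (_ + _)%N.
have nE : n = #|[pred j | k j != None]|.
  have E (p : pred 'I_N) : #|p| = (\sum_(j < N) p j)%N.
    by rewrite -sum1_card big_mkcond /=; apply: eq_bigr => j _; rewrite unfold_in; case: (p j).
  rewrite /n /jump_count !E -big_split /=.
  by apply: eq_bigr => j _; rewrite !ffunE; case: (k j) => [[[] l]|].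
transitivity ((\prod_(j < N) (if k j == None then 1 - 2 / N%:R else M%:R^-1) : R)%:E).
  rewrite -prodEFin; apply: eq_bigr => j _; rewrite prob_xi ffunE.
  rewrite (prob_tau j (measurable_time_set j (k j))).
  have lam (i : nat) : i%:R / N%:R = (i * m)%:R / M%:R :> R.
    by rewrite /M !natrM -mulf_div divff ?mulr1// pnatr_eq0 -lt0n.
  case kj : (k j) => [[c l]|] /=.
    rewrite uniform_prob_oc.
    - rewrite -EFinM; congr (_%:E); rewrite -!mulrBl -!natrB// !subSnn /M natrM.
      by field; rewrite !pnatr_eq0 -!lt0n m0 (leq_trans _ hN).
    - by rewrite lam ler_pM2r ?invr_gt0// ler_nat leq_addr.
    - by rewrite ler_pM2r ?invr_gt0// ler_nat.
    - by rewrite lam ler_pM2r ?invr_gt0// ler_nat mulSn [X in (_ <= X)%N]addnC -addnS leq_add2l.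
  rewrite -prob_tau// (_ : [set w | _] = setT); last by apply/seteqP; split.
  by rewrite probability_setT mule1.
congr (_%:E); rewrite (bigID (fun j => k j == None)) /=; congr (_ * _).
  rewrite (eq_bigr (fun=> 1 - 2 / N%:R)) => [|j ->//].
  rewrite prodr_const; congr (_ ^+ _); rewrite nE.
  have h := cardC [pred j | k j == None]; rewrite card_ord in h.
  have e : #|[predC [pred j | k j == None]]| = #|[pred j | k j != None]| by exact: eq_card.
  rewrite -e.
  have -> : (N - #|[predC [pred j | k j == None]]|)%N = #|[pred j | k j == None]|.
    by rewrite -[X in (X - _)%N]h addnK.
  by [].
rewrite (eq_bigr (fun=> M%:R^-1)) => [|j /negbTE ->//].
by rewrite prodr_const nE.
Qed.
End Level.
End Scheme.

(** * Proportionality of the two laws *)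

Section Proportional.
Variables (R : realType) (N : nat) (hN : (2 <= N)%N).
Variables (d1 : measure_display) (T1 : measurableType d1) (P : probability T1 R)
  (C : bool -> R -> {RV P >-> nat}).
Hypothesis (rateC : forall b, rate1_poisson_process (C b))
  (indC : independent P (fun b => process_sigma_algebra (C b))).
Variables (d2 : measure_display) (T2 : measurableType d2) (Q : probability T2 R)
  (xi : 'I_N -> {RV Q >-> int}) (tau : 'I_N -> {RV Q >-> R}).
Hypothesis (hQ : approximation_scheme xi tau).
Variables (V1 : {RV P >-> jumps R}) (V2 : {RV Q >-> jumps R}).
Hypothesis hV1 : {ae P, forall w, C true 1 w = C false 1 w -> forall t, 0 <= t <= 1 ->
  (C true t w)%:Z - (C false t w)%:Z = path_of (V1 w) t}.
Hypothesis hV2 : {ae Q, forall w, scheme_path xi tau 1 w = 0 -> forall t, 0 <= t <= 1 ->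
  scheme_path xi tau t w = path_of (V2 w) t}.

Let N0 : (0 < N)%N. Proof. exact: leq_trans hN. Qed.

(** The sign vectors of paths which return to 0. *)
Definition balanced n (v : {ffun 'I_n -> option bool}) := jump_count v true == jump_count v false.

Lemma config_path_end m (k : {ffun 'I_N -> option (bool * 'I_m)}) :
  balanced (config_signs k) -> config_path k (N * m) = 0.
Proof. by move=> /eqP h; rewrite config_pathE !sum_config_incr_all h subrr. Qed.

Lemma walk_signs_end (v : {ffun 'I_N -> option bool}) w :
  balanced v -> walk_signs C v w -> C true 1 w = C false 1 w.
Proof.
by move=> /eqP bv hv; rewrite !(walk_signs_count rateC N0 _ hv).
Qed.

Lemma grid_time m (i : 'I_(N * m).+1) : 0 <= (i%:R / (N * m)%:R : R) <= 1.
Proof.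
have [M0|M0] := posnP (N * m)%N.
  by rewrite (_ : (N * m)%:R = 0 :> R) ?M0// invr0 mulr0 lexx ler01.
by rewrite divr_ge0//= ler_pdivrMr ?ltr0n// mul1r ler_nat -ltnS.
Qed.

Definition config_trace m (k : {ffun 'I_N -> option (bool * 'I_m)}) : 'I_(N * m).+1 -> int :=
  fun i => config_path k i.

Section Level.
Variables (m : nat) (m0 : (0 < m)%N) (S : set ('I_(N * m).+1 -> int)).
Variables (v : {ffun 'I_N -> option bool}) (bv : balanced v).
Let G := [set U : jumps R | S (grid_trace (m := N * m) U)].
Hypothesis mG : measurable G.
Let good (k : {ffun 'I_N -> option (bool * 'I_m)}) :=
  (config_signs k == v) && `[< S (config_trace k) >].

Let M1 : (N * m)%:R / (N * m)%:R = 1 :> R.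
Proof. by rewrite divff// pnatr_eq0 -lt0n muln_gt0 N0. Qed.

(** Almost surely on the event of the configuration k, the jump times V1 describe
    the path of k on the grid; the events of the configurations are disjoint. *)
Lemma prob_walk_grid :
  P (walk_signs C v `&` V1 @^-1` G) = (\sum_(k | good k) P (walk_config C k))%E.
Proof.
apply: measure_finite_partition.
- apply: measurableI; first exact: measurable_walk_signs.
  by rewrite -[X in measurable X]setTI; exact: measurable_funP.
- exact: measurable_walk_config.
- exact: walk_config_disjoint.
have key k w : (C true 1 w = C false 1 w -> forall t, 0 <= t <= 1 ->
    (C true t w)%:Z - (C false t w)%:Z = path_of (V1 w) t) ->
    config_signs k = v -> walk_config C (m := m) k w ->
    grid_trace (m := N * m) (V1 w) = config_trace k.
  move=> hw kv hk; apply/funext => i.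
  have e : C true 1 w = C false 1 w.
    by apply: (walk_signs_end bv); apply/(walk_signs_config rateC m0); exists k.
  by rewrite /grid_trace -(hw e _ (grid_time i)) (walk_config_path rateC hk)// -ltnS.
apply: filterS hV1 => w hw; split.
  move=> [/(walk_signs_config rateC m0)[k kv hk] SV]; exists k => //.
  by apply/andP; split; [exact/eqP|apply/asboolP; rewrite -(key k w)].
move=> [k /andP[/eqP kv /asboolP Sk] hk]; split.
  by apply/(walk_signs_config rateC m0); exists k.
by rewrite /G /= (key k w).
Qed.

Lemma prob_scheme_grid :
  Q (scheme_signs xi v `&` V2 @^-1` G) = (\sum_(k | good k) Q (scheme_config xi tau k))%E.
Proof.
apply: measure_finite_partition.
- apply: measurableI; first exact: measurable_scheme_signs.
  by rewrite -[X in measurable X]setTI; exact: measurable_funP.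
- exact: measurable_scheme_config.
- by apply: scheme_config_disjoint.
have key k w : (scheme_path xi tau 1 w = 0 -> forall t, 0 <= t <= 1 ->
    scheme_path xi tau t w = path_of (V2 w) t) ->
    config_signs k = v -> scheme_config xi tau (m := m) k w ->
    grid_trace (m := N * m) (V2 w) = config_trace k.
  move=> hw kv hk; apply/funext => i.
  have e : scheme_path xi tau 1 w = 0.
    by rewrite -M1 (scheme_config_path hN m0 _ hk) config_path_end// kv.
  by rewrite /grid_trace -(hw e _ (grid_time i)) (scheme_config_path hN m0 _ hk).
apply: filterS (filterI hV2 (ae_scheme_signs_config hN hQ m0 v)) => w [hw hc]; split.
  move=> [/hc[k kv hk] SV]; exists k => //.
  by apply/andP; split; [exact/eqP|apply/asboolP; rewrite -(key k w)].
move=> [k /andP[/eqP kv /asboolP Sk] hk]; split; first by apply/hc; exists k.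
by rewrite /G /= (key k w).
Qed.

Lemma scheme_walk_grid :
  Q (scheme_signs xi v `&` V2 @^-1` G) =
  ((expR 2 * (1 - 2 / N%:R) ^+ (N - (jump_count v true + jump_count v false)))%:E *
    P (walk_signs C v `&` V1 @^-1` G))%E.
Proof.
rewrite prob_walk_grid prob_scheme_grid ge0_sume_distrr//.
apply: eq_bigr => k /andP[/eqP <- _].
rewrite (prob_scheme_config hN hQ m0) (prob_walk_config rateC indC N0 m0).
rewrite -EFinM; congr (_%:E).
by rewrite mulrACA -expRD (_ : 2 + -2 = 0 :> R) ?expR0 ?mul1r// subrr.
Qed.
End Level.

(** The ratio of the probabilities of a configuration for the two processes does
    not depend on the positions of the jumps, so that the two laws agree up to a
    constant on every grid, and therefore on the whole sigma-algebra. *)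
Lemma scheme_walk_law (v : {ffun 'I_N -> option bool}) (B : set (jumps R)) :
  balanced v -> measurable B ->
  Q (scheme_signs xi v `&` V2 @^-1` B) =
  ((expR 2 * (1 - 2 / N%:R) ^+ (N - (jump_count v true + jump_count v false)))%:E *
    P (walk_signs C v `&` V1 @^-1` B))%E.
Proof.
move=> bv.
have c0 : 0 <= expR 2 * (1 - 2 / N%:R) ^+ (N - (jump_count v true + jump_count v false)) :> R.
  rewrite mulr_ge0 ?expR_ge0// exprn_ge0// subr_ge0 ler_pdivrMr ?ltr0n//.
  by rewrite mul1r (ler_nat R 2).
have [mQ QE] := exists_restr_push 1%:nng V2 (measurable_scheme_signs xi v).
have {}QE A : mQ A = Q (scheme_signs xi v `&` V2 @^-1` A) by rewrite QE mul1e.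
have [mP PE] := exists_restr_push (NngNum c0) V1 (measurable_walk_signs C v).
move: B; suff h : forall B, measurable B -> mQ B = mP B.
  by move=> B mB; rewrite -QE -PE h.
apply: eq_measure_jumps.
  rewrite QE; apply: le_lt_trans (probability_le1 Q _) _; last exact: ltry.
  by rewrite preimage_setT setIT; exact: measurable_scheme_signs.
move=> A [mA [m [S [m0 EA]]]]; rewrite QE PE.
rewrite EA in mA *.
have [f Ef] := grid_trace_refine R m0 N0.
have -> : grid_trace (m := m) @^-1` S =
    [set U : jumps R | [set h : 'I_(N * m).+1 -> int | S (h \o f)] (grid_trace (m := N * m) U)].
  by apply/seteqP; split => U /=; rewrite Ef.
apply: scheme_walk_grid => //.
by move: mA; congr measurable; apply/seteqP; split => U /=; rewrite Ef.
Qed.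
End Proportional.

(** * Counting sign vectors and numerical estimates *)

Lemma ffact_add N m k : (N ^_ (m + k) = N ^_ m * (N - m) ^_ k)%N.
Proof.
elim: k => [|k IH]; first by rewrite addn0 ffactn0 muln1.
by rewrite addnS !ffactnSr IH subnDA mulnA.
Qed.

(** A sign vector is a pair of disjoint sets of cells; ordering each of them
    yields an injective choice of 2n cells. *)
Lemma card_signs N n :
  (#|[pred v : {ffun 'I_N -> option bool} | (jump_count v true == n) && (jump_count v false == n)]|
   * (n`! * n`!) = N ^_ (2 * n))%N.
Proof.
pose f (v : {ffun 'I_N -> option bool}) : {set 'I_N} * {set 'I_N} :=
  ([set j | v j == Some true]%SET, [set j | v j == Some false]%SET).
pose D (A : {set 'I_N}) := [set B : {set 'I_N} | (B \subset ~: A) && (#|B| == n)]%SET.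
have DE A B : (B \in D A) = (B \subset ~: A)%SET && (#|B| == n) by rewrite inE.
have finj : injective f.
  move=> v v' [/setP e1 /setP e2]; apply/ffunP => j.
  by move: (e1 j) (e2 j); rewrite !inE; case: (v j) (v' j) => [[]|] [[]|].
rewrite -(fintype.card_image finj).
have -> : #|[seq f v | v in [pred v | (jump_count v true == n) && (jump_count v false == n)]]| =
    #|[set AB : {set 'I_N} * {set 'I_N} | (#|AB.1| == n) && (AB.2 \in D AB.1)]%SET|.
  apply: eq_card => -[A B]; rewrite [RHS]inE /= DE.
  apply/fintype.imageP/idP => [[v]|].
    rewrite inE => /andP[/eqP vt /eqP vf] [-> ->].
    have -> : #|[set j | v j == Some true]%SET| = n by rewrite cardsE -vt.
    have -> : #|[set j | v j == Some false]%SET| = n by rewrite cardsE -vf.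
    rewrite !eqxx andbT /=; apply/fintype.subsetP => j; rewrite !inE => /eqP ->//.
  move=> /and3P[/eqP cA /fintype.subsetP BA /eqP cB].
  have BA' j : j \in B -> (j \in A) = false by move=> /BA; rewrite inE => /negbTE.
  pose v := [ffun j => if j \in A then Some true else if j \in B then Some false else None].
  have eA : [set j | v j == Some true]%SET = A.
    by apply/setP => j; rewrite !inE ffunE; case: (j \in A) => //; case: (j \in B).
  have eB : [set j | v j == Some false]%SET = B.
    apply/setP => j; rewrite !inE ffunE; case jA : (j \in A) => //; last by case: (j \in B).
    by apply/esym/negbTE/negP => /BA'; rewrite jA.
  exists v; last by rewrite /f eA eB.
  have jt : jump_count v true = n by rewrite -cA -eA cardsE.
  have jf : jump_count v false = n by rewrite -cB -eB cardsE.
  by rewrite inE jt jf !eqxx.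
have -> : #|[set AB : {set 'I_N} * {set 'I_N} | (#|AB.1| == n) && (AB.2 \in D AB.1)]%SET| =
   ('C(N, n) * 'C(N - n, n))%N.
  rewrite -sum1_card (eq_bigl (fun AB : {set 'I_N} * {set 'I_N} =>
    (#|AB.1| == n) && (AB.2 \in D AB.1))); last first.
    by move=> AB; rewrite inE.
  rewrite -(pair_big_dep (fun A : {set 'I_N} => #|A| == n)
    (fun A B => B \in D A) (fun _ _ => 1%N)) /=.
  rewrite (eq_bigr (fun=> 'C(N - n, n))) => [|A /eqP cA].
    rewrite sum_nat_const; congr muln.
    rewrite -[in RHS](card_ord N) -cardsT -cards_draws.
    by apply: eq_card => A; rewrite !inE finset.subsetT.
  by rewrite sum1_card cards_draws cardsCs finset.setCK cA card_ord.
by rewrite mulnACA !bin_ffact mul2n -addnn ffact_add.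
Qed.

Section Numerics.
Variable R : realType.
Implicit Types (n k N : nat).

(** Once the terms at least halve, the rest of the series is at most twice its
    first term. *)
Lemma sum_halving_le (u : nat -> R) k0 K : (forall n, 0 <= u n) ->
  (forall n, (k0 <= n)%N -> 2 * u n.+1 <= u n) ->
  \sum_(i < k0) u i + 2 * u k0 <= K -> forall k, \sum_(i < k) u i <= K.
Proof.
move=> u0 uS h0 k.
have h n : \sum_(i < k0 + n) u i + 2 * u (k0 + n)%N <= K.
  elim: n => [|n IH]; first by rewrite addn0.
  rewrite addnS big_ord_recr /=; have := uS (k0 + n)%N (leq_addr _ _).
  by move: IH; lra.
have [kk0|kk0] := ltnP k0 k.
  rewrite -(subnKC (ltnW kk0)); apply: le_trans (h (k - k0)%N).
  by rewrite lerDl mulr_ge0.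
apply: le_trans (h 0%N); rewrite addn0 -(subnKC kk0) big_split_ord /= -addrA lerDl.
by rewrite addr_ge0 ?mulr_ge0// sumr_ge0.
Qed.

Lemma sum_inv_fact2_1 k : \sum_(n < k) n%:R / (n`!%:R ^+ 2) <= 2 :> R.
Proof.
apply: (@sum_halving_le (fun n => n%:R / (n`!%:R ^+ 2)) 1).
- by move=> n; rewrite divr_ge0// exprn_ge0.
- move=> n n1; rewrite factS natrM exprMn.
  have n0 : 0 < n%:R :> R by rewrite ltr0n.
  have f0 : 0 < n`!%:R :> R by rewrite ltr0n fact_gt0.
  rewrite invfM mulrA mulrA ler_pM2r ?invr_gt0 ?exprn_gt0//.
  rewrite ler_pdivrMr ?exprn_gt0 ?ltr0n//.
  by rewrite -natrX -!natrM ler_nat; nia.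
- by rewrite big_ord1 mul0r add0r (_ : 1`! = 1%N)// expr1n divr1 mulr1.
Qed.

Lemma sum_inv_fact2_3 k :
  \sum_(n < k) n%:R * (n%:R * (2 * n%:R - 1)) / (n`!%:R ^+ 2) <= 13 / 2 :> R.
Proof.
apply: (@sum_halving_le (fun n => n%:R * (n%:R * (2 * n%:R - 1)) / (n`!%:R ^+ 2)) 3).
- move=> [|n]; first by rewrite !mul0r.
  by rewrite divr_ge0 ?exprn_ge0// !mulr_ge0// -natr1 subr_ge0; have := ler0n R n; lra.
- move=> n n1; rewrite factS natrM exprMn.
  have n0 : 0 < n%:R :> R by rewrite ltr0n (leq_trans _ n1).
  have f0 : 0 < n`!%:R :> R by rewrite ltr0n fact_gt0.
  rewrite [leLHS](_ : _ = 2 * (n.+1%:R * (n.+1%:R * (2 * n.+1%:R - 1)))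
    / n.+1%:R ^+ 2 / n`!%:R ^+ 2); last first.
    by rewrite invfM !mulrA.
  rewrite ler_pM2r ?invr_gt0 ?exprn_gt0//.
  rewrite ler_pdivrMr ?exprn_gt0 ?ltr0n//.
  have : 3 <= n%:R :> R by rewrite (ler_nat R 3).
  rewrite -(natr1 n); move: (n%:R : R) => x x3.
  have -> : 2 * ((x + 1) * ((x + 1) * (2 * (x + 1) - 1))) = (x + 1) ^+ 2 * (4 * x + 2) by ring.
  have -> : x * (x * (2 * x - 1)) * (x + 1) ^+ 2 = (x + 1) ^+ 2 * (x ^+ 2 * (2 * x - 1)) by ring.
  rewrite ler_wpM2l ?sqr_ge0//; apply: (@le_trans _ _ (9 * (2 * x - 1))); first by lra.
  rewrite ler_wpM2r//; first by lra.
  have -> : 9 = 3 ^+ 2 :> R by ring.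
  by rewrite lerXn2r ?nnegrE//; lra.
- rewrite !big_ord_recr big_ord0 /= !factS fact0; lra.
Qed.

(** The birthday bound: k uniform choices among N cells collide with probability
    at most k(k-1)/(2N). *)
Lemma ffact_ratio_ge N k : (0 < N)%N ->
  1 - k%:R * (k%:R - 1) / (2 * N%:R) <= (N ^_ k)%:R / N%:R ^+ k :> R.
Proof.
move=> N0; have N0r : 0 < N%:R :> R by rewrite ltr0n.
have le1 j : (N ^_ j)%:R / N%:R ^+ j <= 1 :> R.
  elim: j => [|j IH]; first by rewrite ffactn0 expr0 divr1.
  rewrite ffactnSr natrM exprSr -mulf_div -[leRHS]mulr1 ler_pM ?divr_ge0 ?exprn_ge0//.
  by rewrite ler_pdivrMr// mul1r ler_nat leq_subr.
elim: k => [|k IH]; first by rewrite mul0r mul0r subr0 ffactn0 expr0 divr1.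
rewrite ffactnSr natrM exprSr -[leRHS]mulf_div.
have h1 : 1 - k%:R / N%:R <= (N - k)%:R / N%:R :> R.
  rewrite lerBlDr -mulrDl ler_pdivlMr// mul1r -natrD ler_nat; lia.
have h2 : 0 <= (N ^_ k)%:R / N%:R ^+ k :> R by rewrite divr_ge0 ?exprn_ge0.
have k0 : 0 <= k%:R / N%:R :> R by rewrite divr_ge0.
have -> : 1 - k.+1%:R * (k.+1%:R - 1) / (2 * N%:R) =
    1 - k%:R * (k%:R - 1) / (2 * N%:R) - k%:R / N%:R :> R.
  have -> : k.+1%:R = k%:R + 1 :> R by rewrite natr1.
  by field; rewrite gt_eqF.
have key (q z c a : R) : 1 - c <= z -> 0 <= q -> q <= 1 -> 0 <= c -> a <= q -> a - c <= q * z.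
  move=> cz q0 q1 c0 aq; apply: (@le_trans _ _ (q * (1 - c))); last by rewrite ler_wpM2l.
  have h4 : q * c <= c by rewrite ler_piMl.
  by rewrite mulrBr mulr1; lra.
exact: key.
Qed.

(** From the third factor on, the factors N - i of the falling factorial do not
    exceed N - 2, so that the ratio is largest at k = 0. *)
Lemma ffact_ratio_le N k : (3 <= N)%N ->
  (N ^_ k.+2)%:R / (N%:R - 2) ^+ k.+2 <= 1 + (3 * N%:R - 4) / (N%:R - 2) ^+ 2 :> R.
Proof.
move=> N3; have N2 : 0 < N%:R - 2 :> R by rewrite subr_gt0 (ltr_nat R 2).
elim: k => [|k IH].
  rewrite ffactnS ffactn1 natrM -subn1 natrB ?(leq_trans _ N3)//.
  by rewrite le_eqVlt; apply/orP; left; apply/eqP; field; rewrite gt_eqF.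
apply: le_trans IH; rewrite ffactnSr natrM exprSr -mulf_div.
have z1 : (N - k.+2)%:R / (N%:R - 2) <= 1 :> R.
  by rewrite ler_pdivrMr// mul1r -(natrB _ (ltnW N3)) ler_nat; lia.
by rewrite -[leRHS]mulr1 ler_wpM2l// divr_ge0// exprn_ge0// ltW.
Qed.

(** The term 2 (3N-4)/(N-2)^2 comes from the larger weight of the jumps in the
    approximation.  The term 13/N is twice the bound 13/(2N) on the mass, weighted
    by the number of jumps, of the paths with two jumps in one cell: these paths
    have no counterpart in the approximation, and without them the walk falls short
    of the weights 1/n!^2 by the same amount. *)
Definition wasserstein_bound N : R := 2 * ((3 * N%:R - 4) / (N%:R - 2) ^+ 2) + 13 / N%:R.

Lemma wasserstein_bound_le N : (5 <= N)%N ->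
  wasserstein_bound N <= 1 / N%:R * (9 * (9 * N%:R ^+ 3 - 54 * N%:R ^+ 2 + 64 * N%:R - 16)
      / (N%:R - 2) ^+ 3).
Proof.
move=> N5; rewrite /wasserstein_bound.
have [m Em] : exists m : nat, N = (m + 5)%N by exists (N - 5)%N; rewrite subnK.
rewrite Em natrD; have m0 : 0 <= m%:R :> R by []; move: (m%:R) m0 => x x0.
rewrite -subr_ge0.
have -> : 1 / (x + 5) * (9 * (9 * (x + 5) ^+ 3 - 54 * (x + 5) ^+ 2 + 64 * (x + 5) - 16)
      / (x + 5 - 2) ^+ 3) - (2 * ((3 * (x + 5) - 4) / (x + 5 - 2) ^+ 2) + 13 / (x + 5)) =
  (62 * x ^+ 3 + 542 * x ^+ 2 + 1174 * x + 30) / ((x + 5) * (x + 3) ^+ 3).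
  by field; apply/andP; split; apply: lt0r_neq0; lra.
apply: divr_ge0.
  have key (a b c e : nat) : 0 <= a%:R * x ^+ 3 + b%:R * x ^+ 2 + c%:R * x + e%:R.
    by rewrite !addr_ge0 ?mulr_ge0 ?exprn_ge0.
  exact: (key 62 542 1174 30)%N.
by apply: mulr_ge0; rewrite ?exprn_ge0// addr_ge0.
Qed.
End Numerics.

Section Comparison.
Variable R : realType.

(** The difference of the quotients is (XL - X - r)/UL plus the first integral
    (X + r)/(U + rho0) times the relative difference of the masses.  Both
    differences are at most K + rho: the second one since the terms with n = 0
    cancel and n >= 1 elsewhere.  The masses are at least 2 and the integral over
    the second law is at most 2 before normalisation, so that each summand
    contributes at most half of K + rho. *)
Lemma ratio_diff_le (I : finType) (S : pred I) (n : I -> nat) (x u l : I -> R)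
    (r rho0 rho K : R) :
  (forall i, 0 <= u i) -> (forall i, S i -> `|x i| <= (n i)%:R * u i) ->
  (forall i, 1 <= l i) -> (forall i, n i = 0%N -> l i = 1) ->
  \sum_(i | S i) (n i)%:R * ((l i - 1) * u i) <= K ->
  `|r| <= rho -> 0 <= rho0 -> rho0 <= rho ->
  `|\sum_(i | S i) x i + r| <= 2 -> 2 <= \sum_(i | S i) u i + rho0 ->
  2 <= \sum_(i | S i) l i * u i ->
  `|(\sum_(i | S i) l i * x i) / (\sum_(i | S i) l i * u i)
    - (\sum_(i | S i) x i + r) / (\sum_(i | S i) u i + rho0)| <= K + rho.
Proof.
move=> u0 xu l1 ln0 hK hr h0 h0r.
set X := \sum_(i | S i) x i; set U := \sum_(i | S i) u i.
set XL := \sum_(i | S i) l i * x i; set UL := \sum_(i | S i) l i * u i.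
move=> Xr2 U2 UL2.
have dX : `|XL - X| <= K.
  rewrite /XL /X -sumrB; apply: le_trans hK; apply: le_trans (ler_norm_sum _ _ _) _.
  apply: ler_sum => i Si; rewrite -{2}[x i]mul1r -mulrBl normrM ger0_norm ?subr_ge0//.
  by rewrite mulrCA ler_wpM2l ?subr_ge0//; exact: xu.
have dU : `|UL - U| <= K.
  rewrite /UL /U -sumrB; apply: le_trans hK; apply: le_trans (ler_norm_sum _ _ _) _.
  apply: ler_sum => i Si; rewrite -{2}[u i]mul1r -mulrBl ger0_norm; last first.
    by rewrite mulr_ge0 ?subr_ge0.
  case ni : (n i) => [|m]; first by rewrite (ln0 _ ni) subrr !mul0r.
  by rewrite ler_peMl ?mulr_ge0 ?subr_ge0// ler1n.
have Z0 : 0 < U + rho0 by apply: lt_le_trans U2.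
have L0 : 0 < UL by apply: lt_le_trans UL2.
have -> : XL / UL - (X + r) / (U + rho0) =
   (XL - X - r) / UL + (X + r) * (U + rho0 - UL) / (UL * (U + rho0)).
  by field; rewrite !gt_eqF.
have h1 : `|XL - X - r| <= K + rho by apply: le_trans (ler_normB _ _) _; exact: lerD.
have h2 : `|U + rho0 - UL| <= K + rho.
  have -> : U + rho0 - UL = rho0 - (UL - U) by ring.
  apply: le_trans (ler_normB _ _) _; rewrite addrC; apply: lerD => //.
  by rewrite ger0_norm.
have D0 : 0 <= K + rho by apply: le_trans h1.
apply: le_trans (ler_normD _ _) _.
rewrite [leRHS](_ : _ = (K + rho) / 2 + 2 * (K + rho) / (2 * 2)); last by field.
apply: lerD; rewrite normrM.
  rewrite normfV (ger0_norm (ltW L0)) ler_pM ?invr_ge0 ?(ltW L0)//.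
  by rewrite lef_pV2 ?posrE.
rewrite normrM normfV (ger0_norm (mulr_ge0 (ltW L0) (ltW Z0))).
rewrite ler_pM ?mulr_ge0 ?invr_ge0 ?mulr_ge0 ?(ltW L0) ?(ltW Z0)//.
  by rewrite ler_pM.
by rewrite lef_pV2 ?posrE ?mulr_gt0// ler_pM.
Qed.

Lemma sum_balanced N (F : nat -> R) :
  \sum_(v : {ffun 'I_N -> option bool} | balanced v) F (jump_count v true) =
  \sum_(n < N.+1) (N ^_ (2 * n))%:R / (n`!%:R ^+ 2) * F n.
Proof.
have lt (v : {ffun 'I_N -> option bool}) : (jump_count v true < N.+1)%N.
  by rewrite ltnS -[X in (_ <= X)%N](card_ord N) max_card.
rewrite (partition_big (fun v => Ordinal (lt v)) xpredT)//=.
apply: eq_bigr => n _.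
rewrite (eq_bigl (fun v => (jump_count v true == n) && (jump_count v false == n))); last first.
  move=> v; rewrite /balanced -val_eqE /= andbC; case: eqP => //= ->.
  by rewrite eq_sym.
rewrite (eq_bigr (fun=> F n)); last by move=> v /andP[/eqP ->].
rewrite sumr_const -[LHS]mulr_natl; congr (_ * _).
by rewrite -card_signs !natrM expr2 mulfK// mulf_neq0// pnatr_eq0 -lt0n fact_gt0.
Qed.

Section Constants.
Variable N : nat.
Hypothesis N5 : (5 <= N)%N.
Let lam : R := N%:R / (N%:R - 2).
Let N0 : 0 < N%:R :> R. Proof. by rewrite ltr0n (leq_trans _ N5). Qed.
Let N2 : 0 < N%:R - 2 :> R. Proof. by rewrite subr_gt0 (ltr_nat R 2) (leq_trans _ N5). Qed.

Let lamE n : lam ^+ n * N%:R^-1 ^+ n = (N%:R - 2)^-1 ^+ n.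
Proof. by rewrite -exprMn /lam mulrAC divff ?gt_eqF// mul1r. Qed.

(** Times exp(-2), the left side is the probability that the walk makes n jumps
    of each sign, at least two of them in the same cell. *)
Lemma signs_defect_le n :
  (n`!%:R ^+ 2)^-1 - (N ^_ (2 * n))%:R / (n`!%:R ^+ 2) * N%:R^-1 ^+ (2 * n) <=
  n%:R * (2 * n%:R - 1) / (n`!%:R ^+ 2) / N%:R :> R.
Proof.
have f0 : 0 < n`!%:R ^+ 2 :> R by rewrite exprn_gt0// ltr0n fact_gt0.
have h := ffact_ratio_ge R (2 * n) (ltnW (ltnW (ltnW (ltnW N5)))).
rewrite [leLHS](_ : _ = (1 - (N ^_ (2 * n))%:R / N%:R ^+ (2 * n)) / (n`!%:R ^+ 2)); last first.
  by rewrite exprVn; field; rewrite !gt_eqF// exprn_gt0.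
rewrite [leRHS](_ : _ = n%:R * (2 * n%:R - 1) / N%:R / (n`!%:R ^+ 2)); last by rewrite mulrAC.
rewrite ler_pM2r ?invr_gt0//; move: h.
rewrite (_ : (2 * n)%:R * ((2 * n)%:R - 1) / (2 * N%:R) = n%:R * (2 * n%:R - 1) / N%:R).
  by lra.
by rewrite natrM; field; rewrite gt_eqF.
Qed.

(** For n >= 1 the difference of the two weights is the excess of the
    approximation over 1/n!^2 plus the defect of the walk below 1/n!^2. *)
Lemma weighted_excess_le :
  \sum_(v : {ffun 'I_N -> option bool} | balanced v) (jump_count v true)%:R *
    ((lam ^+ (2 * jump_count v true) - 1) * N%:R^-1 ^+ (2 * jump_count v true)) <=
  2 * ((3 * N%:R - 4) / (N%:R - 2) ^+ 2) + 13 / 2 / N%:R.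
Proof.
rewrite (sum_balanced N (fun n => n%:R * ((lam ^+ (2 * n) - 1) * N%:R^-1 ^+ (2 * n)))).
have c0 : 0 <= (3 * N%:R - 4) / (N%:R - 2) ^+ 2 :> R.
  by rewrite divr_ge0 ?exprn_ge0 ?(ltW N2)//; move: N2; lra.
apply: (@le_trans _ _ (\sum_(n < N.+1) (n%:R / (n`!%:R ^+ 2) * ((3 * N%:R - 4) / (N%:R - 2) ^+ 2) +
   n%:R * (n%:R * (2 * n%:R - 1)) / (n`!%:R ^+ 2) / N%:R))).
  apply: ler_sum => -[[|n] lt] _ /=.
    by rewrite !mul0r mulr0 add0r.
  have f0 : 0 < (n.+1)`!%:R ^+ 2 :> R by rewrite exprn_gt0// ltr0n fact_gt0.
  rewrite mulrBl mul1r lamE.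
  have h1 := ffact_ratio_le R (2 * n) (leq_trans (isT : 3 <= 5)%N N5).
  rewrite (_ : (2 * n).+2 = (2 * n.+1)%N) in h1; last by rewrite mulnS.
  have h2 := signs_defect_le n.+1.
  rewrite [leLHS](_ : _ = n.+1%:R *
    (((N ^_ (2 * n.+1))%:R / (N%:R - 2) ^+ (2 * n.+1)) / (n.+1)`!%:R ^+ 2 -
     (N ^_ (2 * n.+1))%:R / (n.+1)`!%:R ^+ 2 * N%:R^-1 ^+ (2 * n.+1))); last first.
    by rewrite exprVn; field; rewrite !gt_eqF ?exprn_gt0.
  rewrite [leRHS](_ : _ = n.+1%:R * ((3 * N%:R - 4) / (N%:R - 2) ^+ 2 / (n.+1)`!%:R ^+ 2 +
     n.+1%:R * (2 * n.+1%:R - 1) / (n.+1)`!%:R ^+ 2 / N%:R)); last first.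
    by field; rewrite !gt_eqF.
  rewrite ler_wpM2l//.
  have h3 : (N ^_ (2 * n.+1))%:R / (N%:R - 2) ^+ (2 * n.+1) / (n.+1)`!%:R ^+ 2 <=
     (1 + (3 * N%:R - 4) / (N%:R - 2) ^+ 2) / (n.+1)`!%:R ^+ 2 :> R.
    by rewrite ler_wpM2r// invr_ge0 ltW.
  have key (a b c e f : R) : f - b <= e -> a <= f + c -> a - b <= c + e by lra.
  by apply: key h2 _; rewrite mulrDl mul1r in h3.
rewrite big_split /= -!mulr_suml; apply: lerD.
  by rewrite ler_wpM2r//; exact: sum_inv_fact2_1.
by rewrite ler_wpM2r ?invr_ge0 ?(ltW N0)//; exact: sum_inv_fact2_3.
Qed.

(** The sign vectors with at most one jump of each sign suffice. *)
Lemma weighted_mass_ge :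
  2 <= \sum_(v : {ffun 'I_N -> option bool} | balanced v)
    lam ^+ (2 * jump_count v true) * N%:R^-1 ^+ (2 * jump_count v true).
Proof.
rewrite (sum_balanced N (fun n => lam ^+ (2 * n) * N%:R^-1 ^+ (2 * n))).
rewrite big_ord_recl /= (bigD1 (Ordinal (leq_trans _ N5 : 0 < N)%N))//=.
rewrite addrA; apply: (@le_trans _ _ (1 + 1)); first by lra.
apply: (@le_trans _ _ (1 + 1 + 0)); first by rewrite addr0.
apply: lerD; [apply: lerD|].
- by rewrite muln0 ffactn0 !expr0 (_ : 0`! = 1%N)// expr1n divr1 !mulr1.
- rewrite /bump /= muln1 lamE ffactnS ffactn1 (_ : 1`! = 1%N)// expr1n divr1.
  rewrite exprVn ler_pdivlMr ?exprn_gt0// mul1r.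
  have -> : N%:R - 2 = (N - 2)%:R :> R by rewrite natrB// (leq_trans _ N5).
  by rewrite -natrX ler_nat; nia.
- by apply: sumr_ge0 => i _; rewrite lamE mulr_ge0 ?divr_ge0 ?exprn_ge0 ?invr_ge0 ?(ltW N2).
Qed.
End Constants.
End Comparison.

(** * Comparison of the bridges *)

Section Bridges.
Variables (R : realType) (N : nat) (N5 : (5 <= N)%N).
Variables (d1 : measure_display) (T1 : measurableType d1) (P : probability T1 R)
  (C : bool -> R -> {RV P >-> nat}).
Hypothesis (rateC : forall b, rate1_poisson_process (C b))
  (indC : independent P (fun b => process_sigma_algebra (C b))).
Variables (d2 : measure_display) (T2 : measurableType d2) (Q : probability T2 R)
  (xi : 'I_N -> {RV Q >-> int}) (tau : 'I_N -> {RV Q >-> R}).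
Hypothesis (hQ : approximation_scheme xi tau).
Variables (V1 : {RV P >-> jumps R}) (V2 : {RV Q >-> jumps R}).
Hypothesis hV1 : {ae P, forall w, C true 1 w = C false 1 w -> forall t, 0 <= t <= 1 ->
  (C true t w)%:Z - (C false t w)%:Z = path_of (V1 w) t}.
Hypothesis hV2 : {ae Q, forall w, scheme_path xi tau 1 w = 0 -> forall t, 0 <= t <= 1 ->
  scheme_path xi tau t w = path_of (V2 w) t}.
Implicit Types v : {ffun 'I_N -> option bool}.

Let N2 : (2 <= N)%N. Proof. exact: leq_trans N5. Qed.
Let N0 : (0 < N)%N. Proof. exact: leq_trans N5. Qed.
Let N0r : 0 < N%:R :> R. Proof. by rewrite ltr0n. Qed.
Let N2r : 0 < N%:R - 2 :> R. Proof. by rewrite subr_gt0 (ltr_nat R 2) (leq_trans _ N5). Qed.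
Let c2 : R := expR (-2).
Let c2_gt0 : 0 < c2. Proof. exact: expR_gt0. Qed.

Definition walk_closed : set T1 := [set w | C true 1 w = C false 1 w].
(** The paths which return to 0 and have at most one jump in each cell.  For the
    scheme this is almost surely the same as returning to 0. *)
Definition walk_regular : set T1 := \bigcup_(v in [set` @balanced N]) walk_signs C v.
Definition scheme_regular : set T2 := \bigcup_(v in [set` @balanced N]) scheme_signs xi v.

Lemma measurable_walk_closed : measurable walk_closed.
Proof.
by apply: (@measurable_discrete2 _ _ _ _ (C true 1) (C false 1) eq) => x;
  exact: measurable_count.
Qed.

Lemma measurable_walk_regular : measurable walk_regular.
Proof.
by apply: fin_bigcup_measurable => [|v _]; [exact: finite_finset|exact: measurable_walk_signs].
Qed.

Lemma measurable_scheme_regular : measurable scheme_regular.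
Proof.
by apply: fin_bigcup_measurable => [|v _]; [exact: finite_finset|exact: measurable_scheme_signs].
Qed.

Lemma walk_signs_disjoint v v' w : walk_signs C v w -> walk_signs C v' w -> v = v'.
Proof.
move=> h h'; apply/ffunP => j.
have e b : (v j == Some b) = (v' j == Some b).
  by have := h b j; rewrite (h' b j); do 2 case: (_ == _).
case vj : (v j) => [b|]; first by apply/esym/eqP; rewrite -e vj.
case vj' : (v' j) => [b|]//.
by have := e b; rewrite vj vj' eqxx.
Qed.

Lemma scheme_signs_disjoint v v' w : scheme_signs xi v w -> scheme_signs xi v' w -> v = v'.
Proof. by move=> h h'; apply/ffunP => j; apply: sign_val_inj; rewrite -h -h'. Qed.

(** On the coarsest grid, m = 1, a sign vector is a configuration. *)
Lemma prob_walk_signs v : P (walk_signs C v) =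
  (c2 * N%:R^-1 ^+ (jump_count v true + jump_count v false))%:E.
Proof.
pose k0 : {ffun 'I_N -> option (bool * 'I_1)} := [ffun j => omap (fun b => (b, ord0)) (v j)].
have kE k : (config_signs k == v) = (k == k0).
  apply/eqP/eqP => [kv|->]; apply/ffunP => j; rewrite !ffunE.
    by rewrite -kv ffunE; case: (k j) => [[b l]|]//=; rewrite ord1.
  by case: (v j).
rewrite (@measure_finite_partition _ _ _ P _ (fun k => config_signs k == v)
  (walk_config C (m := 1)))//.
- rewrite (eq_bigl _ _ kE) big_pred1_eq (prob_walk_config rateC indC N0 (ltn0Sn 0)) muln1.
  by have -> : config_signs k0 = v by apply/eqP; rewrite kE.
- exact: measurable_walk_signs.
- exact: measurable_walk_config.
- exact: walk_config_disjoint.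
- apply: aeW => w; rewrite (walk_signs_config rateC (ltn0Sn 0)).
  by split => -[k] => [/eqP kv|/eqP kv] hk; exists k.
Qed.

Lemma prob_scheme_signs v : balanced v -> Q (scheme_signs xi v) =
  ((1 - 2 / N%:R) ^+ (N - (jump_count v true + jump_count v false)) *
   N%:R^-1 ^+ (jump_count v true + jump_count v false))%:E.
Proof.
move=> bv; have := scheme_walk_law N2 rateC indC hQ hV1 hV2 bv measurableT.
rewrite !preimage_setT !setIT prob_walk_signs -EFinM => ->; congr (_%:E).
by rewrite mulrACA /c2 -expRD subrr expR0 mul1r.
Qed.

Lemma closed_count n : walk_closed `&` C true 1 @^-1` [set n] =
  [set w | C true 1 w = n /\ C false 1 w = n].
Proof.
apply/seteqP; split => w /=; rewrite /walk_closed /=; first by move=> [<- ->].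
by move=> [-> ->].
Qed.

Lemma measurable_closed_count n : measurable (walk_closed `&` C true 1 @^-1` [set n]).
Proof. by apply: measurableI; [exact: measurable_walk_closed|exact: measurable_count]. Qed.

Lemma integral_count_closed :
  (\int[P]_(w in walk_closed) (C true 1 w)%:R%:E <= (2 * c2)%:E)%E.
Proof.
apply: (@integral_nat_le _ _ _ P _ _ (fun n => n%:R / (n`!%:R ^+ 2) * c2)).
- exact: measurable_walk_closed.
- by move=> n; exact: measurable_count.
- move=> n; rewrite closed_count (prob_end_counts rateC indC) -EFinM lee_fin.
  by rewrite mulrC [c2 / _]mulrC mulrA.
- by move=> k; rewrite -mulr_suml ler_wpM2r ?(ltW c2_gt0)//; exact: sum_inv_fact2_1.
Qed.

Lemma prob_closed_count_regular n :
  P (walk_closed `&` C true 1 @^-1` [set n] `&` walk_regular) =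
  (c2 * ((N ^_ (2 * n))%:R / (n`!%:R ^+ 2) * N%:R^-1 ^+ (2 * n)))%:E.
Proof.
pose S v := (jump_count v true == n) && (jump_count v false == n).
rewrite (@measure_finite_partition _ _ _ P _ S (walk_signs C (N := N))).
- rewrite (eq_bigr (fun=> (c2 * N%:R^-1 ^+ (2 * n))%:E)) => [|v /andP[/eqP vt /eqP vf]].
    have cS : (#|S| * (n`! * n`!))%N = N ^_ (2 * n) by exact: card_signs.
    rewrite sumEFin sumr_const -cS !natrM expr2 mulfK.
      by congr (_%:E); rewrite -[LHS]mulr_natl mulrCA.
    by rewrite mulf_neq0// pnatr_eq0 -lt0n fact_gt0.
  by rewrite prob_walk_signs vt vf addnn mul2n.
- by apply: measurableI; [exact: measurable_closed_count|exact: measurable_walk_regular].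
- by move=> v; exact: measurable_walk_signs.
- exact: walk_signs_disjoint.
- apply: aeW => w; rewrite closed_count; split.
    move=> [[ht hf] [v bv hv]]; exists v => //.
    by rewrite /S -!(walk_signs_count rateC N0 _ hv) ht hf eqxx.
  move=> [v /andP[/eqP vt /eqP vf] hv]; split.
    by rewrite /= !(walk_signs_count rateC N0 _ hv).
  by exists v; first exact/eqP/(etrans vt).
Qed.

Lemma prob_closed_count n : P (walk_closed `&` C true 1 @^-1` [set n]) =
  (c2 / (n`!%:R ^+ 2))%:E.
Proof. by rewrite closed_count (prob_end_counts rateC indC). Qed.

(** For each n, the event of n jumps of each sign loses the sign vectors counted
    by [card_signs], and what remains is the defect of [signs_defect_le]. *)
Lemma integral_count_irregular :
  (\int[P]_(w in walk_closed `\` walk_regular) (C true 1 w)%:R%:E <=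
   (13 / 2 / N%:R * c2)%:E)%E.
Proof.
apply: (@integral_nat_le _ _ _ P _ _
  (fun n => n%:R * (n%:R * (2 * n%:R - 1)) / (n`!%:R ^+ 2) / N%:R * c2)).
- by apply: measurableD; [exact: measurable_walk_closed|exact: measurable_walk_regular].
- by move=> n; exact: measurable_count.
- move=> n.
  have -> : (walk_closed `\` walk_regular) `&` C true 1 @^-1` [set n] =
      (walk_closed `&` C true 1 @^-1` [set n]) `\` walk_regular.
    by apply/seteqP; split => w /= [[h1 h2] h3].
  set a := P _.
  have fa : a \is a fin_num.
    apply: fin_num_measure.
    by apply: measurableD; [exact: measurable_closed_count|exact: measurable_walk_regular].
  have : (c2 / (n`!%:R ^+ 2))%:E =
     (a + (c2 * ((N ^_ (2 * n))%:R / (n`!%:R ^+ 2) * N%:R^-1 ^+ (2 * n)))%:E)%E.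
    rewrite -prob_closed_count -prob_closed_count_regular.
    by apply: measureDI; [exact: measurable_closed_count|exact: measurable_walk_regular].
  rewrite -(fineK fa) -EFinD => -[e].
  have -> : fine a = c2 * ((n`!%:R ^+ 2)^-1 -
      (N ^_ (2 * n))%:R / (n`!%:R ^+ 2) * N%:R^-1 ^+ (2 * n)).
    by rewrite mulrBr e addrK.
  rewrite -EFinM lee_fin.
  have h := signs_defect_le R N5 n.
  rewrite mulrC mulrCA mulrC ler_wpM2r ?(ltW c2_gt0)//.
  apply: le_trans (ler_wpM2l (ler0n R n) h) _.
  by rewrite !mulrA.
- move=> k; rewrite -!mulr_suml ler_wpM2r ?(ltW c2_gt0)// ler_wpM2r ?invr_ge0 ?(ltW N0r)//.
  exact: sum_inv_fact2_3.
Qed.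

Lemma prob_closed_ge : ((2 * c2)%:E <= P walk_closed)%E.
Proof.
pose A n := walk_closed `&` C true 1 @^-1` [set n].
have -> : (2 * c2)%:E = P (A 0%N `|` A 1%N).
  transitivity (P (A 0%N) + P (A 1%N))%E.
    rewrite (prob_closed_count 0) (prob_closed_count 1) !expr1n !divr1 -EFinD.
    by congr (_%:E); ring.
  rewrite measureU//; [exact: measurable_closed_count|exact: measurable_closed_count|].
  by apply/seteqP; split => w // [[_ e0] [_ e1]]; have := etrans (esym e0) e1.
apply: le_measure; rewrite ?inE.
- by apply: measurableU; exact: measurable_closed_count.
- exact: measurable_walk_closed.
- by move=> w [[]|[]].
Qed.

(** All times are at most 1, so that the final position is the sum of the signs. *)
Lemma ae_scheme_closed :
  {ae Q, forall w, scheme_path xi tau 1 w = 0 <-> scheme_regular w}.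
Proof.
apply: filterS (ae_scheme_nondegenerate N2 hQ) => w [[v hv] ht].
have e : scheme_path xi tau 1 w = (jump_count v true)%:Z - (jump_count v false)%:Z.
  rewrite /scheme_path big_mkcond /=.
  transitivity (\sum_(j < N) (((v j == Some true) : nat)%:Z - ((v j == Some false) : nat)%:Z)).
    apply: eq_bigr => j _; have /andP[_ tj] := ht j.
    rewrite (le_trans tj) ?hv; first by case: (v j) => [[]|].
    by rewrite ler_pdivrMr// mul1r ler_nat.
  rewrite sumrB /jump_count -!sum1_card -!natz !natr_sum.
  by congr (_ - _); rewrite [RHS]big_mkcond; apply: eq_bigr => j _; rewrite inE; case: (_ == _).
rewrite e; split.
  by move=> /eqP; rewrite subr_eq0 => /eqP[b]; exists v => //; apply/eqP.
move=> [v' /eqP bv' hv']; have <- := scheme_signs_disjoint hv' hv.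
by rewrite bv' subrr.
Qed.

Lemma measurable_scheme_closed : measurable [set w | scheme_path xi tau 1 w = 0].
Proof.
have msum (s : seq 'I_N) (f : 'I_N -> T2 -> int) :
    (forall j a, measurable (f j @^-1` [set a])) ->
    forall a, measurable ((fun w => \sum_(j <- s) f j w) @^-1` [set a]).
  move=> mf; elim: s => [|j s IH] a.
    rewrite (_ : _ @^-1` _ = [set w | 0 = a]).
      by have [->|na] := eqVneq 0 a; [rewrite (_ : mkset _ = setT)|rewrite (_ : mkset _ = set0)];
      rewrite ?measurableT ?measurable0//; apply/seteqP; split => w //= /eqP; rewrite (negbTE na).
    by apply/seteqP; split => w /=; rewrite big_nil.
  rewrite (_ : _ @^-1` _ = [set w | f j w + \sum_(j <- s) f j w = a]).
    exact: (@measurable_discrete2 _ _ _ _ (f j) (fun w => \sum_(j <- s) f j w)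
      (fun x y => x + y = a)).
  by apply/seteqP; split => w /=; rewrite big_cons.
rewrite (_ : mkset _ = (fun w => \sum_(j < N) (if tau j w <= 1 then xi j w else 0)) @^-1` [set 0]).
  apply: msum => j a.
  apply: (@measurable_discrete2 _ T2 bool int (fun w => tau j w <= 1) (xi j)
    (fun b x => (if b then x else 0) = a)) => [b|x]; last exact: measurable_xi.
  rewrite (_ : _ @^-1` _ = [set w | [set t | (t <= 1) = b] (tau j w)])//.
  apply: measurable_tau; case: b.
    rewrite (_ : mkset _ = `]-oo, 1]%classic); first exact: measurable_itv.
    by apply/seteqP; split => t /=; rewrite in_itv.
  rewrite (_ : mkset _ = `]1, +oo[%classic); first exact: measurable_itv.
  by apply/seteqP; split => t /=; rewrite in_itv /= andbT ltNge; [move=> ->|move/negbTE].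
have e w : scheme_path xi tau 1 w = \sum_(j < N) (if tau j w <= 1 then xi j w else 0).
  by rewrite /scheme_path big_mkcond.
by apply/seteqP; split => w /=; rewrite e.
Qed.

(** The hypothesis on g is what remains of the Lipschitz condition for a function
    which vanishes at the empty configuration. *)
Section TestFunction.
Variable g : jumps R -> R.
Hypothesis (mg : measurable_fun [set: jumps R] g) (gb : forall U, `|g U| <= #|` U.1|%:R).

Let mgV1 : measurable_fun [set: T1] (g \o V1). Proof. exact: measurableT_comp. Qed.
Let mgV2 : measurable_fun [set: T2] (g \o V2). Proof. exact: measurableT_comp. Qed.

(** The jumps of the path are among those of the counting processes, which is all
    that has to be known about the jump times V1. *)
Lemma ae_test_le_count :
  {ae P, forall w, walk_closed w -> `|g (V1 w)| <= (C true 1 w)%:R}.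
Proof.
apply: filterS hV1 => w hw cw; apply: le_trans (gb _) _; rewrite ler_nat.
apply: (@card_jumps_le _ _ (fun t => C true t w) (fun t => C false t w)).
- by move=> s t s0 st _; have [_ h _ _ _] := rateC true; exact: h.
- by move=> s t s0 st _; have [_ h _ _ _] := rateC false; exact: h.
- by move=> t t01; rewrite -(hw cw t t01).
Qed.

Lemma measurable_count_real : measurable_fun [set: T1] (fun w => (C true 1 w)%:R : R).
Proof.
by apply: (measurableT_comp (f := fun n : nat => n%:R : R)).
Qed.

Lemma test_bound (D : set T1) (K : R) : measurable D -> D `<=` walk_closed ->
  (\int[P]_(w in D) (C true 1 w)%:R%:E <= K%:E)%E ->
  P.-integrable D (EFin \o (g \o V1)) /\ `|Rintegral P D (g \o V1)| <= K.
Proof.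
move=> mD DW hK.
apply: (@Rintegral_ae_bound _ _ _ P D (g \o V1) (fun w => (C true 1 w)%:R)) => //.
- exact: measurable_count_real.
- by apply: filterS ae_test_le_count => w h /DW; exact: h.
Qed.

Lemma walk_signs_closed v : balanced v -> walk_signs C v `<=` walk_closed.
Proof. by move=> bv w hv; exact: (walk_signs_end N2 rateC bv hv). Qed.

Lemma test_signs_bound v : balanced v ->
  P.-integrable (walk_signs C v) (EFin \o (g \o V1)) /\
  `|Rintegral P (walk_signs C v) (g \o V1)| <=
    (jump_count v true)%:R * (c2 * N%:R^-1 ^+ (2 * jump_count v true)).
Proof.
move=> bv; apply: test_bound; [exact: measurable_walk_signs|exact: walk_signs_closed|].
rewrite (eq_integral (fun=> (jump_count v true)%:R%:E)); last first.
  by move=> w; rewrite inE => hv; rewrite (walk_signs_count rateC N0 _ hv).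
rewrite integral_cst; last exact: measurable_walk_signs.
by rewrite /= prob_walk_signs -(eqP bv) addnn mul2n -EFinM.
Qed.

Let lam : R := N%:R / (N%:R - 2).
Let gam : R := (1 - 2 / N%:R) ^+ N.

Let p0 : 0 < 1 - 2 / N%:R :> R.
Proof. by rewrite subr_gt0 ltr_pdivrMr// mul1r -subr_gt0. Qed.

(** An empty cell has probability 1 - 2/N = 1/lambda, whence the density
    lambda^(2n). *)
Lemma scheme_sign_weight v : balanced v ->
  (1 - 2 / N%:R) ^+ (N - (jump_count v true + jump_count v false)) =
  gam * lam ^+ (2 * jump_count v true).
Proof.
move=> bv; rewrite -(eqP bv) addnn -mul2n.
have le : (2 * jump_count v true <= N)%N.
  rewrite mul2n -addnn {2}(eqP bv) -[X in (_ <= X)%N](card_ord N) /jump_count.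
  rewrite -cardUI [X in (_ + X)%N]eq_card0 ?addn0 ?max_card// => j.
  by rewrite !inE; case: (v j) => [[]|].
have -> : gam = (1 - 2 / N%:R) ^+ (N - 2 * jump_count v true) *
    (1 - 2 / N%:R) ^+ (2 * jump_count v true).
  by rewrite -exprD subnK.
rewrite -mulrA -exprMn.
have -> : (1 - 2 / N%:R) * lam = 1 by rewrite /lam; field; rewrite !gt_eqF.
by rewrite expr1n mulr1.
Qed.

(** Both integrals split over the balanced sign vectors, on which they are
    proportional; only the walk has a remainder, carried by the paths with two
    jumps in one cell.  The common factors exp(-2) and (1 - 2/N)^N cancel in the
    normalised integrals, which leaves the situation of [ratio_diff_le]. *)
Lemma test_comparison :
  [/\ P.-integrable walk_closed (EFin \o (g \o V1)),
      Q.-integrable scheme_regular (EFin \o (g \o V2)) &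
      `|Rintegral Q scheme_regular (g \o V2) / fine (Q scheme_regular)
        - Rintegral P walk_closed (g \o V1) / fine (P walk_closed)| <= wasserstein_bound R N].
Proof.
have [iW IW] := integrable_finite_union (measurable_walk_signs C (N := N)) mgV1
  walk_signs_disjoint (fun v bv => (test_signs_bound bv).1).
have mirr : measurable (walk_closed `\` walk_regular).
  by apply: measurableD; [exact: measurable_walk_closed|exact: measurable_walk_regular].
have [iR IR] := test_bound mirr (@subDsetl _ _ _) integral_count_irregular.
have [iC IC] := test_bound measurable_walk_closed (fun w h => h) integral_count_closed.
have WC : walk_regular `<=` walk_closed by move=> w [v bv hv]; exact: (walk_signs_closed bv).
have UE : walk_regular `|` (walk_closed `\` walk_regular) = walk_closed.
  by rewrite setUDr setDv setD0 setUidr.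
have UD : [disjoint walk_regular & walk_closed `\` walk_regular].
  by apply/disj_set2P; apply/seteqP; split => w //= [hw [_ nw]].
have I1 : Rintegral P walk_closed (g \o V1) =
    \sum_(v : {ffun 'I_N -> option bool} | balanced v) Rintegral P (walk_signs C v) (g \o V1) +
    Rintegral P (walk_closed `\` walk_regular) (g \o V1).
  transitivity (Rintegral P walk_regular (g \o V1) +
    Rintegral P (walk_closed `\` walk_regular) (g \o V1)).
    by rewrite -[in LHS]UE Rintegral_setU// ?UE//; exact: measurable_walk_regular.
  by congr (_ + _); exact: IW.
pose cst v := expR 2 * (1 - 2 / N%:R) ^+ (N - (jump_count v true + jump_count v false)) : R.
have cE v : balanced v -> cst v = c2^-1 * (gam * lam ^+ (2 * jump_count v true)).
  by move=> bv; rewrite /cst scheme_sign_weight// /c2 expRN invrK.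
have cst0 v : 0 <= cst v by rewrite /cst mulr_ge0 ?expR_ge0// exprn_ge0// ltW.
have mV1 : measurable_fun [set: T1] V1 by exact: measurable_funP.
have mV2 : measurable_fun [set: T2] V2 by exact: measurable_funP.
have law v (bv : balanced v) B (mB : measurable B) :=
  scheme_walk_law N2 rateC indC hQ hV1 hV2 bv mB.
have iG v : balanced v -> Q.-integrable (scheme_signs xi v) (EFin \o (g \o V2)).
  move=> bv; exact: (integrable_proportional (measurable_walk_signs C v)
    (measurable_scheme_signs xi v) mV1 mV2 (cst0 v) (law v bv) mg (test_signs_bound bv).1).
have IG v : balanced v -> Rintegral Q (scheme_signs xi v) (g \o V2) =
    cst v * Rintegral P (walk_signs C v) (g \o V1).
  move=> bv; exact: (Rintegral_proportional (measurable_walk_signs C v)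
    (measurable_scheme_signs xi v) mV1 mV2 (cst0 v) (law v bv) mg (test_signs_bound bv).1).
have [iS IS] := integrable_finite_union (measurable_scheme_signs xi) mgV2
  scheme_signs_disjoint iG.
split => //.
set r := c2^-1 * Rintegral P (walk_closed `\` walk_regular) (g \o V1).
pose x v := c2^-1 * Rintegral P (walk_signs C v) (g \o V1).
pose u v : R := N%:R^-1 ^+ (2 * jump_count v true).
pose rho0 := c2^-1 * fine (P (walk_closed `\` walk_regular)).
have gam0 : 0 < gam by rewrite exprn_gt0.
have c2V : 0 < c2^-1 by rewrite invr_gt0.
have E1 : Rintegral P walk_closed (g \o V1) =
    c2 * (\sum_(v : {ffun 'I_N -> option bool} | balanced v) x v + r).
  by rewrite I1 /x /r -mulr_sumr -mulrDr mulrA divff ?gt_eqF// mul1r.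
have z1 : fine (P walk_closed) =
    c2 * (\sum_(v : {ffun 'I_N -> option bool} | balanced v) u v + rho0).
  have zW : P walk_regular = (c2 * \sum_(v : {ffun 'I_N -> option bool} | balanced v) u v)%:E.
    rewrite (@measure_finite_partition _ _ _ P _ (@balanced N) (walk_signs C (N := N))).
    - rewrite mulr_sumr -sumEFin; apply: eq_bigr => v bv.
      by rewrite prob_walk_signs -(eqP bv) addnn -mul2n.
    - exact: measurable_walk_regular.
    - exact: measurable_walk_signs.
    - exact: walk_signs_disjoint.
    - by apply: aeW => w; split => [[v bv hv]|[v bv hv]]; exists v.
  have -> : P walk_closed = (P walk_regular + P (walk_closed `\` walk_regular))%E.
    rewrite -{1}UE measureU//; first exact: measurable_walk_regular.
    exact/disj_set2P.
  rewrite fineD ?fin_num_measure//; last exact: measurable_walk_regular.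
  by rewrite zW /= mulrDr /rho0 mulrA divff ?gt_eqF// mul1r.
have E2 : Rintegral Q scheme_regular (g \o V2) =
    gam * \sum_(v : {ffun 'I_N -> option bool} | balanced v) lam ^+ (2 * jump_count v true) * x v.
  rewrite IS mulr_sumr; apply: eq_bigr => v bv; rewrite IG// cE// /x.
  by rewrite -mulrA mulrCA -mulrA; congr (_ * _); exact: mulrCA.
have z2 : fine (Q scheme_regular) =
    gam * \sum_(v : {ffun 'I_N -> option bool} | balanced v) lam ^+ (2 * jump_count v true) * u v.
  rewrite (@measure_finite_partition _ _ _ Q _ (@balanced N) (scheme_signs xi)).
  - rewrite mulr_sumr -[RHS]/(fine _%:E) -sumEFin; congr fine; apply: eq_bigr => v bv.
    by rewrite prob_scheme_signs// scheme_sign_weight// -(eqP bv) addnn -mul2n -mulrA.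
  - exact: measurable_scheme_regular.
  - exact: measurable_scheme_signs.
  - exact: scheme_signs_disjoint.
  - by apply: aeW => w; split => [[v bv hv]|[v bv hv]]; exists v.
have cancel (a b c : R) : 0 < c -> (c * a) / (c * b) = a / b.
  by move=> c0; rewrite -mulf_div divff ?gt_eqF// mul1r.
rewrite E1 E2 z1 z2 !cancel//.
have -> : wasserstein_bound R N =
    (2 * ((3 * N%:R - 4) / (N%:R - 2) ^+ 2) + 13 / 2 / N%:R) + 13 / 2 / N%:R.
  by rewrite /wasserstein_bound -addrA; congr (_ + _); field; rewrite gt_eqF.
have lam1 : 1 <= lam by rewrite /lam ler_pdivlMr// mul1r; lra.
apply: (ratio_diff_le (n := fun v => jump_count v true)).
- by move=> v; rewrite exprn_ge0// invr_ge0 ltW.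
- move=> v bv; rewrite /x normrM gtr0_norm// mulrC ler_pdivrMr//.
  by apply: le_trans (test_signs_bound bv).2 _; rewrite mulrCA mulrC.
- by move=> v; exact: exprn_ege1.
- by move=> v ->.
- exact: weighted_excess_le.
- rewrite /r normrM gtr0_norm// mulrC ler_pdivrMr//.
- by rewrite /rho0 mulr_ge0 ?fine_ge0// ltW.
- rewrite /rho0 mulrC ler_pdivrMr// -lee_fin fineK; last exact: fin_num_measure.
  apply: le_trans integral_count_irregular.
  rewrite -[leLHS]mul1e -integral_cst//; apply: ge0_le_integral => //.
  - by apply: measurable_funTS; apply/measurable_EFinP; exact: measurable_count_real.
  - move=> w [cw nw]; rewrite lee_fin (ler_nat _ 1) lt0n; apply/negP => /eqP w0.
    (* Without jumps the path is regular, so an irregular path has a jump. *)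
    apply: nw; exists [ffun=> None]; first by apply/eqP; apply: eq_card => j; rewrite !inE ffunE.
    move=> b j; rewrite ffunE /=.
    have b0 : C b 1 w = 0%N by case: b => //; rewrite -cw.
    have [_ h _ _ _] := rateC b.
    have : (C b (j.+1%:R / N%:R) w <= C b 1 w)%N.
      by apply: h; rewrite ?divr_ge0// ler_pdivrMr// mul1r ler_nat.
    by rewrite b0 leqn0 => /eqP ->.
- by rewrite -(ler_pM2l c2_gt0) -{1}(gtr0_norm c2_gt0) -normrM -E1 mulrC.
- rewrite -(ler_pM2l c2_gt0) -z1 mulrC -lee_fin fineK; first exact: prob_closed_ge.
  by apply: fin_num_measure; exact: measurable_walk_closed.
- exact: weighted_mass_ge.
Qed.
End TestFunction.

End Bridges.

(** * The bound on the Wasserstein distance *)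

(* The right-hand side is negative for N = 1, 3, 4 and has a vanishing
   denominator for N = 2, whence 5 <= N. *)
Theorem theorem3p30 (R : realType) (N : nat) (hN : (5 <= N)%N)
    (d1 : measure_display) (T1 : measurableType d1) (P : probability T1 R)
    (X : R -> T1 -> int) (hX : random_walk P X)
    (P00 : probability (jumps R) R) (hP00 : bridge_law P X P00)
    (d2 : measure_display) (T2 : measurableType d2) (Q : probability T2 R)
    (xi : 'I_N -> {RV Q >-> int}) (tau : 'I_N -> {RV Q >-> R})
    (hQ : approximation_scheme xi tau)
    (P00N : probability (jumps R) R) (hP00N : bridge_law Q (scheme_path xi tau) P00N) :
  (dW1 P00N P00 <=
    (1 / N%:R *
     (9 * (9 * N%:R ^+ 3 - 54 * N%:R ^+ 2 + 64 * N%:R - 16)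
      / (N%:R - 2) ^+ 3))%:E)%E.
Proof.
have [C [rateC indC XE]] := hX.
have [V1 hV1 P00E] := hP00; have [V2 hV2 P00NE] := hP00N.
have X1 w : X 1 w = (C true 1 w)%:Z - (C false 1 w)%:Z by exact: XE.
have closedE : [set w | X 1 w = 0] = walk_closed C.
  apply/seteqP; split => w; rewrite /walk_closed /= X1; last by move=> ->; rewrite subrr.
  by move=> /eqP; rewrite subr_eq0 => /eqP[].
have {}hV1 : {ae P, forall w, C true 1 w = C false 1 w -> forall t, 0 <= t <= 1 ->
    (C true t w)%:Z - (C false t w)%:Z = path_of (V1 w) t}.
  apply: filterS hV1 => w h cw t t01.
  rewrite -h//; last by rewrite X1 cw subrr.
  by rewrite XE//; case/andP: t01.
have mV1 : measurable_fun [set: T1] V1 by exact: measurable_funP.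
have mV2 : measurable_fun [set: T2] V2 by exact: measurable_funP.
have mC := measurable_walk_closed C.
have mS := measurable_scheme_regular xi.
pose U0 : jumps R := Jumps _ (is_jumps0 R).
rewrite /dW1; apply: ge_ereal_sup => _ [f [fL fN f0] <-].
rewrite lee_fin.
have mf : measurable_fun [set: jumps R] f by case: fL.
pose g U := f U - f U0.
have mg : measurable_fun [set: jumps R] g by exact: measurable_funB.
have gb U : `|g U| <= #|` U.1|%:R by exact: Lip1_le_card.
have shift (mu : probability (jumps R) R) : mu.-integrable setT (EFin \o f) ->
    Rintegral mu setT f = Rintegral mu setT g + f U0.
  move=> fi; rewrite /g RintegralB//.
    by rewrite Rintegral_cst//= probability_setT mulr1 subrK.
  exact: finite_measure_integrable_cst.
rewrite !shift// opprD addrACA subrr addr0.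
have [iC iS bound] := test_comparison hN rateC indC hQ hV1 hV2 mg gb.
have E0 : Rintegral P00 setT g =
    (fine (P (walk_closed C)))^-1 * Rintegral P (walk_closed C) (g \o V1).
  apply: (Rintegral_proportional (V2 := idfun) mC measurableT mV1 (@measurable_id _ _ setT)) => //.
    by rewrite invr_ge0 fine_ge0.
  move=> B mB; rewrite setTI preimage_id; apply: etrans (P00E B mB) _.
  rewrite closedE EFinM fineK 1?muleC//.
  apply: fin_num_measure; apply: measurableI => //.
  by rewrite -[X in measurable X]setTI; exact: mV1.
have EN : Rintegral P00N setT g =
    (fine (Q (scheme_regular xi)))^-1 * Rintegral Q (scheme_regular xi) (g \o V2).
  apply: (Rintegral_proportional (V2 := idfun) mS measurableT mV2 (@measurable_id _ _ setT)) => //.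
    by rewrite invr_ge0 fine_ge0.
  have mc := measurable_scheme_closed xi tau.
  have hc := ae_scheme_closed hN hQ.
  have mVB B : measurable B -> measurable (V2 @^-1` B).
    by move=> mB; rewrite -[X in measurable X]setTI; exact: mV2.
  move=> B mB; rewrite setTI preimage_id; apply: etrans (P00NE B mB) _.
  rewrite (@ae_eq_measure _ _ _ Q [set w | scheme_path xi tau 1 w = 0] (scheme_regular xi))//.
  rewrite (@ae_eq_measure _ _ _ Q ([set w | scheme_path xi tau 1 w = 0] `&` V2 @^-1` B)
    (scheme_regular xi `&` V2 @^-1` B)).
  - rewrite EFinM fineK 1?muleC//; apply: fin_num_measure; apply: measurableI => //; exact: mVB.
  - by apply: measurableI => //; exact: mVB.
  - by apply: measurableI => //; exact: mVB.
  - by apply: filterS hc => w h; split => -[/h].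
apply: le_trans (wasserstein_bound_le R hN).
by rewrite E0 EN ![_^-1 * _]mulrC.
Qed.
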